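(* (Type safety of $\lambda_{\mathrm{eff}}^{\mathrm{let}}$.) Let $M$ be a term of the surface language $\lambda_{\mathrm{eff}}^{\mathrm{let}}$ and $A$ a type. If $M$ is a well-typed program of $A$, i.e. $\emptyset;\mathsf{none}\vdash M:A\mid\langle\rangle$, then there exists a term $e$ of the intermediate language $\lambda_{\mathrm{eff}}^{\Lambda}$ such that $\emptyset;\mathsf{none}\vdash M:A\mid\langle\rangle\ \triangleright^{\emptyset}\ e$ and $e$ does not get stuck, i.e. whenever $e\longrightarrow^{*}e'$ and there is no $e''$ with $e'\longrightarrow e''$, the term $e'$ is a value.
   Context: **Types (shared by both languages).** Fix a set of effect operations $\mathsf{op}$. An effect $\epsilon$ is a finite set of operations; $\langle\rangle$ is the empty effect. Types: $A,B,C,D::=\alpha\mid\iota\mid A\to^{\epsilon}B$, with $\alpha$ (also $\beta,\gamma$) type variables and $\iota$ base types (bool, int, a designated base type $\bot$, ...). Type schemes: $\sigma::=A\mid\forall\alpha.\sigma$. Bold letters denote finite sequences, possibly with index set as superscript ($\boldsymbol\alpha^{I}$); index sets may be omitted; $\{\boldsymbol\alpha\}$ is the underlying set; $\mathit{ftv}$ denotes free type variables; $B[\boldsymbol A/\boldsymbol\alpha]$ is capture-avoiding simultaneous substitution (equal index sets). $\boldsymbol{\forall\boldsymbol\beta^{J}.C}^{I}$ is the sequence of the schemes $\forall\boldsymbol\beta^J.C_i$, $i\in I$. Each constant $c$ has a closed first-order type $\mathit{ty}(c)=\iota_1\to^{\langle\rangle}\cdots\to^{\langle\rangle}\iota_n$;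 for each $\iota$ there is a set $K_\iota$ of constants with $\mathit{ty}(c)=\iota$ iff $c\in K_\iota$. A partial function $\zeta$ on pairs of constants satisfies: $\zeta(c_1,c_2)$ is defined iff $\mathit{ty}(c_1)=\iota\to^{\langle\rangle}A$ and $\mathit{ty}(c_2)=\iota$ for some $\iota,A$, and then $\zeta(c_1,c_2)$ is a constant with $\mathit{ty}(\zeta(c_1,c_2))=A$. Each operation has a signature $\mathit{ty}(\mathsf{op})=\forall\boldsymbol\alpha.A\hookrightarrow B$ with $\mathit{ftv}(A)\cup\mathit{ftv}(B)\subseteq\{\boldsymbol\alpha\}$. Typing contexts $\Gamma::=\emptyset\mid\Gamma,x:\sigma\mid\Gamma,\alpha$; $\mathit{dom}(\Gamma)$ is the set of declared term and type variables. $\Gamma\vdash\sigma$ iff $\mathit{ftv}(\sigma)\subseteq\mathit{dom}(\Gamma)$ (for sequences: componentwise). $\vdash\Gamma$ is generated by: $\vdash\emptyset$; if $\vdash\Gamma$, $x\notin\mathit{dom}(\Gamma)$, $\Gamma\vdash\sigma$ then $\vdash\Gamma,x:\sigma$; if $\vdash\Gamma$, $\alpha\notin\mathit{dom}(\Gamma)$ then $\vdash\Gamma,\alpha$. Terms are taken up to renaming of bound variables. **Surface language $\lambda_{\mathrm{eff}}^{\mathrm{let}}$.** Terms $M::=x\mid c\mid\lambda x.M\mid M_1\,M_2\mid\mathsf{let}\ x=M_1\ \mathsf{in}\ M_2\mid\#\mathsf{op}(M)\mid\mathsf{handle}\ M\ \mathsf{with}\ H\mid\mathsf{resume}\ M$;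 handlers $H::=\mathsf{return}\ x\to M\mid H;\mathsf{op}(x)\to M$. Resumption types $R::=\mathsf{none}\mid(\boldsymbol\alpha,x:A,B\to^{\epsilon}C)$, the latter only if $\mathit{ftv}(A)\cup\mathit{ftv}(B)\subseteq\{\boldsymbol\alpha\}$ and $\mathit{ftv}(C)\cap\{\boldsymbol\alpha\}=\emptyset$. Typing $\Gamma;R\vdash M:A\mid\epsilon$ and $\Gamma;R\vdash H:A\mid\epsilon\Rightarrow B\mid\epsilon'$ are the least relations with: - (Var) $\vdash\Gamma$, $x:\forall\boldsymbol\alpha.A\in\Gamma$, $\Gamma\vdash\boldsymbol B$ imply $\Gamma;R\vdash x:A[\boldsymbol B/\boldsymbol\alpha]\mid\epsilon$. - (Const) $\vdash\Gamma$ implies $\Gamma;R\vdash c:\mathit{ty}(c)\mid\epsilon$. - (Abs) $\Gamma,x:A;R\vdash M:B\mid\epsilon'$ implies $\Gamma;R\vdash\lambda x.M:A\to^{\epsilon'}B\mid\epsilon$. - (App) $\Gamma;R\vdash M_1:A\to^{\epsilon'}B\mid\epsilon$, $\Gamma;R\vdash M_2:A\mid\epsilon$, $\epsilon'\subseteq\epsilon$ imply $\Gamma;R\vdash M_1\,M_2:B\mid\epsilon$. - (Let) $\Gamma,\boldsymbol\alpha;R\vdash M_1:A\mid\epsilon$ and $\Gamma,x:\forall\boldsymbol\alpha.A;R\vdash M_2:B\mid\epsilon$ imply $\Gamma;R\vdash\mathsf{let}\ x=M_1\ \mathsf{in}\ M_2:B\mid\epsilon$. - (Weak) $\Gamma;R\vdash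 M:A\mid\epsilon'$, $\epsilon'\subseteq\epsilon$ imply $\Gamma;R\vdash M:A\mid\epsilon$. - (Op) $\mathit{ty}(\mathsf{op})=\forall\boldsymbol\alpha.A\hookrightarrow B$, $\mathsf{op}\in\epsilon$, $\Gamma;R\vdash M:A[\boldsymbol C/\boldsymbol\alpha]\mid\epsilon$, $\Gamma\vdash\boldsymbol C$ imply $\Gamma;R\vdash\#\mathsf{op}(M):B[\boldsymbol C/\boldsymbol\alpha]\mid\epsilon$. - (Handle) $\Gamma;R\vdash M:A\mid\epsilon$ and $\Gamma;R\vdash H:A\mid\epsilon\Rightarrow B\mid\epsilon'$ imply $\Gamma;R\vdash\mathsf{handle}\ M\ \mathsf{with}\ H:B\mid\epsilon'$. - (Resume) with $R=(\boldsymbol\alpha,x:A,B\to^{\epsilon}C)$: $\vdash\Gamma_1,x:D,\Gamma_2$, $\boldsymbol\alpha\in\Gamma_1$, $\epsilon\subseteq\epsilon'$, $\Gamma_1,\Gamma_2,\boldsymbol\beta,x:A[\boldsymbol\beta/\boldsymbol\alpha];R\vdash M:B[\boldsymbol\beta/\boldsymbol\alpha]\mid\epsilon'$ imply $\Gamma_1,x:D,\Gamma_2;R\vdash\mathsf{resume}\ M:C\mid\epsilon'$. - (Return clause) $\Gamma,x:A;R\vdash M:B\mid\epsilon'$, $\epsilon\subseteq\epsilon'$ imply $\Gamma;R\vdash\mathsf{return}\ x\to M:A\mid\epsilon\Rightarrow B\mid\epsilon'$. - (Operation clause) $\Gamma;R\vdash H:A\mid\epsilon\Rightarrow B\mid\epsilon'$,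 $\mathit{ty}(\mathsf{op})=\forall\boldsymbol\alpha.C\hookrightarrow D$, $\Gamma,\boldsymbol\alpha,x:C;(\boldsymbol\alpha,x:C,D\to^{\epsilon'}B)\vdash M:B\mid\epsilon'$ imply $\Gamma;R\vdash H;\mathsf{op}(x)\to M:A\mid\epsilon\uplus\{\mathsf{op}\}\Rightarrow B\mid\epsilon'$ ($\uplus$ = disjoint union). **Syntax of the intermediate language $\lambda_{\mathrm{eff}}^{\Lambda}$.** Values $v::=c\mid\lambda x.e$; polymorphic values $w::=v\mid\Lambda\alpha.w$; terms $e::=x\,\boldsymbol A\mid c\mid\lambda x.e\mid e_1\,e_2\mid\mathsf{let}\ x=\Lambda\boldsymbol\alpha.e_1\ \mathsf{in}\ e_2\mid\#\mathsf{op}(\boldsymbol A,e)\mid\#\mathsf{op}(\boldsymbol\sigma,w,E)\mid\mathsf{handle}\ e\ \mathsf{with}\ h\mid\mathsf{resume}\ \boldsymbol\alpha\,x.e$ (the last binds $\boldsymbol\alpha,x$ in $e$); handlers $h::=\mathsf{return}\ x\to e\mid h;\Lambda\boldsymbol\alpha.\mathsf{op}(x)\to e$. Evaluation contexts $E^{\boldsymbol\alpha}$ are indexed by the type variables bound above the hole: $[\,]$ (empty index); $E^{\boldsymbol\alpha}\,e_2$; $v_1\,E^{\boldsymbol\alpha}$; $\#\mathsf{op}(\boldsymbol A,E^{\boldsymbol\alpha})$; $\mathsf{handle}\ E^{\boldsymbol\alpha}\ \mathsf{with}\ h$ (index $\boldsymbol\alpha$); $\mathsf{let}\ x=\Lambda\boldsymbol\beta.E^{\boldsymbol\gamma}\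 \mathsf{in}\ e_2$ (index $\boldsymbol\beta,\boldsymbol\gamma$). $E$ abbreviates $E^{\boldsymbol\alpha}$; $E[e]$ is hole filling (the type variables in the index are captured). **Substitution in $\lambda_{\mathrm{eff}}^{\Lambda}$.** Type and value substitution are capture-avoiding, with $(x\,\boldsymbol A)[\Lambda\boldsymbol\alpha.v/x]=v[\boldsymbol A/\boldsymbol\alpha]$ (undefined if the lengths of $\boldsymbol A,\boldsymbol\alpha$ differ). Continuation substitution $e[E^{\boldsymbol\beta^J}/\mathsf{resume}]^{\boldsymbol{\forall\boldsymbol\beta^J.A}^I}_{\Lambda\boldsymbol\beta^J.v}$, written $e\,\theta$, is capture-avoiding and homomorphic on terms except: $(\mathsf{resume}\ \boldsymbol\gamma^I z.e)\theta=\mathsf{let}\ y=\Lambda\boldsymbol\beta^J.(e\,\theta)[\boldsymbol A^I/\boldsymbol\gamma^I][v/z]\ \mathsf{in}\ E^{\boldsymbol\beta^J}[y\,\boldsymbol\beta^J]$ with $y$ fresh and $(\mathit{ftv}(e)\cup\mathit{ftv}(E^{\boldsymbol\beta^J}))\cap\{\boldsymbol\beta^J\}=\emptyset$; $\#\mathsf{op}(\boldsymbol\sigma,w,E')\theta=\#\mathsf{op}(\boldsymbol\sigma,w\theta,E')$; on handlers, $(\mathsf{return}\ x\to e)\theta=\mathsf{return}\ x\to e\theta$ and $(h';\Lambda\boldsymbol\gamma.\mathsf{op}(x)\to e)\theta=h'\theta;\Lambda\boldsymbol\gamma.\mathsf{op}(x)\to e$ (operation-clause bodies are unchanged). **Semantics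 of $\lambda_{\mathrm{eff}}^{\Lambda}$.** $h^{\mathsf{return}}$ is the return clause of $h$, $\mathit{ops}(h)$ the set of operations handled by $h$, $h^{\mathsf{op}}$ the clause for $\mathsf{op}$. Reduction $\rightsquigarrow$: - $c_1\,c_2\rightsquigarrow\zeta(c_1,c_2)$; $(\lambda x.e)\,v\rightsquigarrow e[v/x]$; $\mathsf{let}\ x=\Lambda\boldsymbol\alpha.v\ \mathsf{in}\ e\rightsquigarrow e[\Lambda\boldsymbol\alpha.v/x]$; $\mathsf{handle}\ v\ \mathsf{with}\ h\rightsquigarrow e[v/x]$ where $h^{\mathsf{return}}=\mathsf{return}\ x\to e$; $\#\mathsf{op}(\boldsymbol A,v)\rightsquigarrow\#\mathsf{op}(\boldsymbol A,v,[\,])$; - $\#\mathsf{op}(\boldsymbol\sigma,w,E)\,e_2\rightsquigarrow\#\mathsf{op}(\boldsymbol\sigma,w,E\,e_2)$; $v_1\,\#\mathsf{op}(\boldsymbol\sigma,w,E)\rightsquigarrow\#\mathsf{op}(\boldsymbol\sigma,w,v_1\,E)$; $\#\mathsf{op}'(\boldsymbol A,\#\mathsf{op}(\boldsymbol\sigma,w,E))\rightsquigarrow\#\mathsf{op}(\boldsymbol\sigma,w,\#\mathsf{op}'(\boldsymbol A,E))$; $\mathsf{handle}\ \#\mathsf{op}(\boldsymbol\sigma,w,E)\ \mathsf{with}\ h\rightsquigarrow\#\mathsf{op}(\boldsymbol\sigma,w,\mathsf{handle}\ E\ \mathsf{with}\ h)$ if $\mathsf{op}\notin\mathit{ops}(h)$;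 $\mathsf{let}\ x=\Lambda\boldsymbol\alpha^I.\#\mathsf{op}(\boldsymbol\sigma^J,w,E)\ \mathsf{in}\ e_2\rightsquigarrow\#\mathsf{op}(\boldsymbol{\forall\boldsymbol\alpha^I.\sigma}^J,\Lambda\boldsymbol\alpha^I.w,\mathsf{let}\ x=\Lambda\boldsymbol\alpha^I.E\ \mathsf{in}\ e_2)$; - $\mathsf{handle}\ \#\mathsf{op}(\boldsymbol{\forall\boldsymbol\beta^J.A}^I,\Lambda\boldsymbol\beta^J.v,E^{\boldsymbol\beta^J})\ \mathsf{with}\ h\rightsquigarrow e[\mathsf{handle}\ E^{\boldsymbol\beta^J}\ \mathsf{with}\ h/\mathsf{resume}]^{\boldsymbol{\forall\boldsymbol\beta^J.A}^I}_{\Lambda\boldsymbol\beta^J.v}\,[\boldsymbol A^I[\boldsymbol\bot/\boldsymbol\beta^J]/\boldsymbol\alpha^I]\,[v[\boldsymbol\bot/\boldsymbol\beta^J]/x]$ where $h^{\mathsf{op}}=\Lambda\boldsymbol\alpha^I.\mathsf{op}(x)\to e$. Evaluation: $E[e_1]\longrightarrow E[e_2]$ whenever $e_1\rightsquigarrow e_2$; $\longrightarrow^{*}$ is its reflexive transitive closure. **Elaboration.** $S$ ranges over mappings from variables to variables; $\emptyset$ also denotes the identity mapping; $S\circ\{x\mapsto y\}$ is $S$ except that $x$ is mapped to $y$. The judgments $\Gamma;R\vdash M:A\mid\epsilon\ \triangleright^S e$ and $\Gamma;R\vdash H:A\mid\epsilon\Rightarrow B\mid\epsilon'\ \triangleright^S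 h$ are the least relations whose rules are those of the surface type system (same premises and side conditions), each typing premise and conclusion being decorated with an output as follows (premises use $S$ unless stated otherwise; primes/indices match subterms): - (Var) $x$ (instantiated with $\boldsymbol B$) $\triangleright^S S(x)\,\boldsymbol B$; (Const) $c\triangleright^S c$; (Weak) same output as the premise. - (Abs) if the body elaborates with $S\circ\{x\mapsto x\}$ to $e$, then $\lambda x.M\triangleright^S\lambda x.e$. - (App) $M_1\,M_2\triangleright^S e_1\,e_2$; (Op) $\#\mathsf{op}(M)$ (instantiated with $\boldsymbol C$) $\triangleright^S\#\mathsf{op}(\boldsymbol C,e)$; (Handle) $\mathsf{handle}\ M\ \mathsf{with}\ H\triangleright^S\mathsf{handle}\ e\ \mathsf{with}\ h$. - (Let) if $M_1\triangleright^S e_1$ (in context $\Gamma,\boldsymbol\alpha$) and $M_2$ elaborates with $S\circ\{x\mapsto x\}$ to $e_2$, then $\mathsf{let}\ x=M_1\ \mathsf{in}\ M_2\triangleright^S\mathsf{let}\ x=\Lambda\boldsymbol\alpha.e_1\ \mathsf{in}\ e_2$. - (Resume) if $y$ is fresh and $M$ elaborates with $S\circ\{x\mapsto y\}$ to $e$ (where $x$ is the variable in $R$ and $\boldsymbol\beta$ the type variables introduced in the premise), then $\mathsf{resume}\ M\triangleright^S\mathsf{resume}\ \boldsymbol\beta\,y.e$. - (Return clause) if $M$ elaborates with $S\circ\{x\mapsto x\}$ to $e$, then $\mathsf{return}\ x\to M\triangleright^S\mathsf{return}\ x\to e$. - (Operation clause) if $H\triangleright^S h$ and $M$ elaborates with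 $S\circ\{x\mapsto x\}$ to $e$, then $H;\mathsf{op}(x)\to M\triangleright^S h;\Lambda\boldsymbol\alpha.\mathsf{op}(x)\to e$. *)

(* Defs.v *)
From mathcomp Require Import all_boot finmap.
From Stdlib Require Export Relation_Operators.

Set Implicit Arguments.
Unset Strict Implicit.
Unset Printing Implicit Defensive.

Local Open Scope fset_scope.
Local Open Scope nat_scope.

(* Terms up to renaming of bound variables are represented with de Bruijn
   indices, separately for term variables and for type variables.

   A type binder binds a whole sequence of n type variables at once: in its
   scope the i-th variable of the sequence is index i (i < n), and older
   variables start at n.  Hence, in a nest of binders of J inside I variables,
   merged into one binder of I + J variables, the J inner ones come first. *)

Inductive ty (base : Type) (op : choiceType) : Type :=
  | TVar of nat
  | TBase of base
  | TArr of ty base op & {fset op} & ty base op.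

Arguments TVar {base op} _.
Arguments TBase {base op} _.
Arguments TArr {base op} _ _ _.

Section Types.
Variables (base : Type) (op : choiceType).
Local Notation ty := (ty base op).

Fixpoint ftv (A : ty) : seq nat :=
  match A with
  | TVar a => [:: a]
  | TBase _ => [::]
  | TArr A1 _ A2 => ftv A1 ++ ftv A2
  end.

Fixpoint tysub (s : nat -> ty) (A : ty) : ty :=
  match A with
  | TVar a => s a
  | TBase i => TBase i
  | TArr A1 eff A2 => TArr (tysub s A1) eff (tysub s A2)
  end.

Definition tshift (k a : nat) : ty := TVar (k + a).

Definition inst (Bs : seq ty) (a : nat) : ty := nth (TVar (a - size Bs)) Bs a.

(* Action of [s] below a binder of n type variables. *)
Definition tup (n : nat) (s : nat -> ty) (a : nat) : ty :=
  if a < n then TVar a else tysub (tshift n) (s (a - n)).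

(* (n, A) is the scheme quantifying n type variables in A. *)
Definition scheme : Type := nat * ty.

Definition mono (A : ty) : scheme := (0, A).

Definition ftv_scheme (s : scheme) : seq nat :=
  [seq a - s.1 | a <- ftv s.2 & s.1 <= a].

Definition scsub (s : nat -> ty) (sg : scheme) : scheme :=
  (sg.1, tysub (tup sg.1 s) sg.2).

Inductive first_order : ty -> Prop :=
  | fo_base i : first_order (TBase i)
  | fo_arr i A : first_order A -> first_order (TArr (TBase i) fset0 A).

End Types.

Arguments tshift {base op} k a.

(* sig o = (n, A, B) stands for  ty(o) = forall a_0 .. a_(n-1), A ~> B. *)
Record language : Type := Language {
  base : Type;
  bot : base;
  operation : choiceType;
  constant : Type;
  ty_const : constant -> ty base operation;
  ty_const_fo : forall c, first_order (ty_const c);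
  zeta : constant -> constant -> option constant;
  zeta_defined : forall c1 c2,
    (exists c, zeta c1 c2 = Some c) <->
    (exists i A, ty_const c1 = TArr (TBase i) fset0 A /\ ty_const c2 = TBase i);
  zeta_ty : forall c1 c2 c i A,
    zeta c1 c2 = Some c ->
    ty_const c1 = TArr (TBase i) fset0 A -> ty_const c2 = TBase i ->
    ty_const c = A;
  sig : operation -> nat * ty base operation * ty base operation;
  sig_closed : forall o n A B, sig o = (n, A, B) ->
    all (fun a => a < n) (ftv A ++ ftv B)
}.

Notation lty L := (ty (base L) (operation L)).
Notation lscheme L := (scheme (base L) (operation L)).
Notation effect L := {fset operation L}.

Section Contexts.
Variable L : language.
Local Notation ty := (lty L).
Local Notation scheme := (lscheme L).

Inductive entry : Type := ETm of scheme | ETy.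

(* The most recent declaration comes first: "G, x : s" is [ETm s :: G], and
   "G1, G2" is [G2 ++ G1].  A scheme is written in the scope of the type
   variables declared before it, and only [ETy] entries count for type
   indices (only [ETm] entries for term indices). *)
Definition context : Type := seq entry.

Definition is_ETm (d : entry) : bool := if d is ETm _ then true else false.
Definition ntm (G : context) : nat := count is_ETm G.
Definition nty (G : context) : nat := count (predC is_ETm) G.

Definition tyvars (n : nat) : context := nseq n ETy.

Fixpoint lookup (G : context) (x : nat) : option scheme :=
  match G, x with
  | [::], _ => None
  | ETm s :: _, 0 => Some s
  | ETm _ :: G', x'.+1 => lookup G' x'
  | ETy :: G', _ => omap (scsub (tshift 1)) (lookup G' x)
  end.

Definition in_scope (G : context) (s : scheme) : bool :=
  all (fun a => a < nty G) (ftv_scheme s).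

Inductive wf_ctx : context -> Prop :=
  | wf_nil : wf_ctx [::]
  | wf_tm G s : wf_ctx G -> in_scope G s -> wf_ctx (ETm s :: G)
  | wf_ty G : wf_ctx G -> wf_ctx (ETy :: G).

End Contexts.

Arguments ETy {L}.
Arguments tyvars {L} n.

Section Surface.
Variable L : language.
Local Notation ty := (lty L).
Local Notation context := (context L).

(* [SResume] binds nothing: the variable of the enclosing operation clause,
   which [resume M] re-declares at another type, is the same in M.
   [SHOp H o M] is "H; o(x) -> M". *)
Inductive stm : Type :=
  | SVar of nat
  | SConst of constant L
  | SLam of stm
  | SApp of stm & stm
  | SLet of stm & stm
  | SOp of operation L & stm
  | SHandle of stm & shandler
  | SResume of stm
with shandler : Type :=
  | SHRet of stm
  | SHOp of shandler & operation L & stm.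

Definition up_ren (r : nat -> nat) (x : nat) : nat :=
  if x is y.+1 then (r y).+1 else 0.

Fixpoint sren (r : nat -> nat) (M : stm) : stm :=
  match M with
  | SVar x => SVar (r x)
  | SConst c => SConst c
  | SLam M1 => SLam (sren (up_ren r) M1)
  | SApp M1 M2 => SApp (sren r M1) (sren r M2)
  | SLet M1 M2 => SLet (sren r M1) (sren (up_ren r) M2)
  | SOp o M1 => SOp o (sren r M1)
  | SHandle M1 H => SHandle (sren r M1) (shren r H)
  | SResume M1 => SResume (sren r M1)
  end
with shren (r : nat -> nat) (H : shandler) : shandler :=
  match H with
  | SHRet M => SHRet (sren (up_ren r) M)
  | SHOp H1 o M => SHOp (shren r H1) o (sren (up_ren r) M)
  end.

(* Renumbering when the declaration with index k of a context is removed and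
   a new one for the same variable is appended at the end. *)
Definition to_front (k x : nat) : nat :=
  if x < k then x.+1 else if x == k then 0 else x.

(* [als], [x] and the free type variables of A, B, C are indices in the context
   of the judgment, hence the shifts of R below binders in the rules. *)
Inductive resty : Type :=
  | RNone
  | RSome (als : seq nat) (x : nat) (A B : ty) (eff : effect L) (C : ty).

Definition wf_resty (R : resty) : bool :=
  match R with
  | RNone => true
  | RSome als _ A B _ C =>
      all (fun a => a \in als) (ftv A ++ ftv B)
      && all (fun a => a \notin als) (ftv C)
  end.

Definition rshift_ty (k : nat) (R : resty) : resty :=
  match R with
  | RNone => RNone
  | RSome als x A B eff C =>
      RSome (map (addn k) als) x (tysub (tshift k) A) (tysub (tshift k) B)
            eff (tysub (tshift k) C)
  end.

Definition rshift_tm (R : resty) : resty :=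
  match R with
  | RNone => RNone
  | RSome als x A B eff C => RSome als x.+1 A B eff C
  end.

(* A[bs/als], where bs are the [size als] most recent type variables. *)
Definition fresh_copy (als : seq nat) (A : ty) : ty :=
  tysub (fun a => TVar (index a als)) A.

(* "G1, x : D, G2" is [G2 ++ ETm (mono D) :: G1], so x is index [ntm G2].
   The premise of (Resume) moves x to the end of the context and introduces
   the [size als] type variables bs; R is renumbered accordingly, hence the
   0 for x. *)
Definition resume_ctx (G1 G2 : context) (als : seq nat) (A : ty) : context :=
  ETm (mono (fresh_copy als A)) :: tyvars (size als) ++ G2 ++ G1.

Definition resume_res (als : seq nat) (A B : ty) (eff : effect L) (C : ty) :=
  rshift_ty (size als) (RSome als 0 A B eff C).

(* All of [als] are declared in G1, as indices in [G2 ++ ETm _ :: G1]. *)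
Definition declared_in (G1 G2 : context) (als : seq nat) : bool :=
  all (fun a => nty G2 <= a < nty G2 + nty G1) als.

(* Context and resumption type of the body of a clause for an operation of
   signature  forall a_0 .. a_(n-1), C ~> D, in a handler of result type B. *)
Definition clause_ctx (G : context) (n : nat) (C : ty) : context :=
  ETm (mono C) :: tyvars n ++ G.

Definition clause_res (n : nat) (C D : ty) (eff : effect L) (B : ty) : resty :=
  RSome (iota 0 n) 0 C D eff (tysub (tshift n) B).

Inductive typing : context -> resty -> stm -> ty -> effect L -> Prop :=
  | T_Var G R x n A Bs eff :
      wf_ctx G -> lookup G x = Some (n, A) ->
      size Bs = n -> all (fun B => in_scope G (mono B)) Bs ->
      typing G R (SVar x) (tysub (inst Bs) A) eff
  | T_Const G R c eff :
      wf_ctx G -> typing G R (SConst c) (ty_const c) eff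
  | T_Abs G R M A B eff eff' :
      typing (ETm (mono A) :: G) (rshift_tm R) M B eff' ->
      typing G R (SLam M) (TArr A eff' B) eff
  | T_App G R M1 M2 A B eff eff' :
      typing G R M1 (TArr A eff' B) eff -> typing G R M2 A eff ->
      eff' `<=` eff ->
      typing G R (SApp M1 M2) B eff
  | T_Let G R M1 M2 n A B eff :
      typing (tyvars n ++ G) (rshift_ty n R) M1 A eff ->
      typing (ETm (n, A) :: G) (rshift_tm R) M2 B eff ->
      typing G R (SLet M1 M2) B eff
  | T_Weak G R M A eff eff' :
      typing G R M A eff' -> eff' `<=` eff -> typing G R M A eff
  | T_Op G R o M n A B Cs eff :
      sig o = (n, A, B) -> o \in eff ->
      typing G R M (tysub (inst Cs) A) eff ->
      size Cs = n -> all (fun C => in_scope G (mono C)) Cs ->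
      typing G R (SOp o M) (tysub (inst Cs) B) eff
  | T_Handle G R M H A B eff eff' :
      typing G R M A eff -> htyping G R H A eff B eff' ->
      typing G R (SHandle M H) B eff'
  | T_Resume G1 G2 D als A B C eff eff' M :
      wf_ctx (G2 ++ ETm (mono D) :: G1) -> declared_in G1 G2 als ->
      eff `<=` eff' ->
      typing (resume_ctx G1 G2 als A) (resume_res als A B eff C)
             (sren (to_front (ntm G2)) M) (fresh_copy als B) eff' ->
      typing (G2 ++ ETm (mono D) :: G1) (RSome als (ntm G2) A B eff C)
             (SResume M) C eff'
(* htyping G R H A eff B eff' :  G; R |- H : A | eff => B | eff' *)
with htyping :
    context -> resty -> shandler -> ty -> effect L -> ty -> effect L -> Prop :=
  | T_HRet G R M A B eff eff' :
      typing (ETm (mono A) :: G) (rshift_tm R) M B eff' -> eff `<=` eff' ->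
      htyping G R (SHRet M) A eff B eff'
  | T_HOp G R H o M n A B C D eff eff' :
      htyping G R H A eff B eff' -> sig o = (n, C, D) ->
      wf_resty (clause_res n C D eff' B) ->
      typing (clause_ctx G n C) (clause_res n C D eff' B)
             M (tysub (tshift n) B) eff' ->
      o \notin eff ->
      htyping G R (SHOp H o M) A (o |` eff) B eff'.

End Surface.

Arguments SVar {L} _.
Arguments RNone {L}.

Section Intermediate.
Variable L : language.
Local Notation ty := (lty L).
Local Notation scheme := (lscheme L).

(* A polymorphic value  /\a_0 .. a_(n-1). v  is given by n and v.
   [OpE o ss n v E] is  #o(ss, /\a_0 .. a_(n-1). v, E);
   [HOp h m o e]    is  h; /\a_0 .. a_(m-1). o(x) -> e.
   [Resume m e] binds m type variables and one term variable.
   The hole of [ELet n E e] is below the n type variables of the let; no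
   constructor of [ectx] binds a term variable above the hole. *)
Inductive val : Type :=
  | Const of constant L
  | Lam of tm
with tm : Type :=
  | Var of nat & seq ty
  | Val of val
  | App of tm & tm
  | Let of nat & tm & tm
  | Op of operation L & seq ty & tm
  | OpE of operation L & seq scheme & nat & val & ectx
  | Handle of tm & handler
  | Resume of nat & tm
with handler : Type :=
  | HRet of tm
  | HOp of handler & nat & operation L & tm
with ectx : Type :=
  | EHole
  | EAppL of ectx & tm
  | EAppR of val & ectx
  | EOp of operation L & seq ty & ectx
  | EHandle of ectx & handler
  | ELet of nat & ectx & tm.

(* Length of the sequence of type variables indexing the context. *)
Fixpoint edepth (E : ectx) : nat :=
  match E with
  | EHole => 0
  | EAppL E1 _ => edepth E1
  | EAppR _ E1 => edepth E1
  | EOp _ _ E1 => edepth E1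
  | EHandle E1 _ => edepth E1
  | ELet n E1 _ => n + edepth E1
  end.

(* Hole filling; capturing type variables is the absence of a shift. *)
Fixpoint plug (E : ectx) (e : tm) : tm :=
  match E with
  | EHole => e
  | EAppL E1 e2 => App (plug E1 e) e2
  | EAppR v1 E1 => App (Val v1) (plug E1 e)
  | EOp o As E1 => Op o As (plug E1 e)
  | EHandle E1 h => Handle (plug E1 e) h
  | ELet n E1 e2 => Let n (plug E1 e) e2
  end.

Fixpoint vtsub (s : nat -> ty) (v : val) : val :=
  match v with
  | Const c => Const c
  | Lam e => Lam (tsub s e)
  end
with tsub (s : nat -> ty) (e : tm) : tm :=
  match e with
  | Var x As => Var x (map (tysub s) As)
  | Val v => Val (vtsub s v)
  | App e1 e2 => App (tsub s e1) (tsub s e2)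
  | Let n e1 e2 => Let n (tsub (tup n s) e1) (tsub s e2)
  | Op o As e1 => Op o (map (tysub s) As) (tsub s e1)
  | OpE o ss n v E =>
      OpE o (map (scsub s) ss) n (vtsub (tup n s) v) (etsub s E)
  | Handle e1 h => Handle (tsub s e1) (htsub s h)
  | Resume m e1 => Resume m (tsub (tup m s) e1)
  end
with htsub (s : nat -> ty) (h : handler) : handler :=
  match h with
  | HRet e => HRet (tsub s e)
  | HOp h1 m o e => HOp (htsub s h1) m o (tsub (tup m s) e)
  end
with etsub (s : nat -> ty) (E : ectx) : ectx :=
  match E with
  | EHole => EHole
  | EAppL E1 e2 => EAppL (etsub s E1) (tsub s e2)
  | EAppR v1 E1 => EAppR (vtsub s v1) (etsub s E1)
  | EOp o As E1 => EOp o (map (tysub s) As) (etsub s E1)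
  | EHandle E1 h => EHandle (etsub s E1) (htsub s h)
  | ELet n E1 e2 => ELet n (etsub (tup n s) E1) (tsub s e2)
  end.

Fixpoint vren (r : nat -> nat) (v : val) : val :=
  match v with
  | Const c => Const c
  | Lam e => Lam (tren (up_ren r) e)
  end
with tren (r : nat -> nat) (e : tm) : tm :=
  match e with
  | Var x As => Var (r x) As
  | Val v => Val (vren r v)
  | App e1 e2 => App (tren r e1) (tren r e2)
  | Let n e1 e2 => Let n (tren r e1) (tren (up_ren r) e2)
  | Op o As e1 => Op o As (tren r e1)
  | OpE o ss n v E => OpE o ss n (vren r v) (eren r E)
  | Handle e1 h => Handle (tren r e1) (hren r h)
  | Resume m e1 => Resume m (tren (up_ren r) e1)
  end
with hren (r : nat -> nat) (h : handler) : handler :=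
  match h with
  | HRet e => HRet (tren (up_ren r) e)
  | HOp h1 m o e => HOp (hren r h1) m o (tren (up_ren r) e)
  end
with eren (r : nat -> nat) (E : ectx) : ectx :=
  match E with
  | EHole => EHole
  | EAppL E1 e2 => EAppL (eren r E1) (tren r e2)
  | EAppR v1 E1 => EAppR (vren r v1) (eren r E1)
  | EOp o As E1 => EOp o As (eren r E1)
  | EHandle E1 h => EHandle (eren r E1) (hren r h)
  | ELet n E1 e2 => ELet n (eren r E1) (tren (up_ren r) e2)
  end.

(* Substitution of polymorphic values for term variables.  It is a partial
   operation: the functions below are total, and [arity] tells whether the
   substitution of /\a_0 .. a_(n-1). v for a variable is defined. *)

Inductive atom : Type :=
  | AVar of nat
  | AVal of nat & val.

Definition app_atom (a : atom) (As : seq ty) : tm :=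
  match a with
  | AVar y => Var y As
  | AVal _ v => Val (vtsub (inst As) v)
  end.

Definition up_tm (s : nat -> atom) (x : nat) : atom :=
  match x with
  | 0 => AVar 0
  | y.+1 => match s y with
            | AVar z => AVar z.+1
            | AVal n v => AVal n (vren succn v)
            end
  end.

Definition up_ty (k : nat) (s : nat -> atom) (x : nat) : atom :=
  match s x with
  | AVar z => AVar z
  | AVal n v => AVal n (vtsub (tup n (tshift k)) v)
  end.

Fixpoint vsub (s : nat -> atom) (v : val) : val :=
  match v with
  | Const c => Const c
  | Lam e => Lam (sub (up_tm s) e)
  end
with sub (s : nat -> atom) (e : tm) : tm :=
  match e with
  | Var x As => app_atom (s x) As
  | Val v => Val (vsub s v)
  | App e1 e2 => App (sub s e1) (sub s e2)
  | Let n e1 e2 => Let n (sub (up_ty n s) e1) (sub (up_tm s) e2)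
  | Op o As e1 => Op o As (sub s e1)
  | OpE o ss n v E => OpE o ss n (vsub (up_ty n s) v) (esub s E)
  | Handle e1 h => Handle (sub s e1) (hsub s h)
  | Resume m e1 => Resume m (sub (up_tm (up_ty m s)) e1)
  end
with hsub (s : nat -> atom) (h : handler) : handler :=
  match h with
  | HRet e => HRet (sub (up_tm s) e)
  | HOp h1 m o e => HOp (hsub s h1) m o (sub (up_tm (up_ty m s)) e)
  end
with esub (s : nat -> atom) (E : ectx) : ectx :=
  match E with
  | EHole => EHole
  | EAppL E1 e2 => EAppL (esub s E1) (sub s e2)
  | EAppR v1 E1 => EAppR (vsub s v1) (esub s E1)
  | EOp o As E1 => EOp o As (esub s E1)
  | EHandle E1 h => EHandle (esub s E1) (hsub s h)
  | ELet n E1 e2 => ELet n (esub (up_ty n s) E1) (sub (up_tm s) e2)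
  end.

(* e[/\a_0 .. a_(n-1). v / x], for x the variable with index 0. *)
Definition sub1 (n : nat) (v : val) (e : tm) : tm :=
  sub (fun x => if x is y.+1 then AVar y else AVal n v) e.

(* Every occurrence of x is applied to exactly n types. *)
Fixpoint varity (x n : nat) (v : val) : bool :=
  match v with
  | Const _ => true
  | Lam e => arity x.+1 n e
  end
with arity (x n : nat) (e : tm) : bool :=
  match e with
  | Var y As => (y == x) ==> (size As == n)
  | Val v => varity x n v
  | App e1 e2 => arity x n e1 && arity x n e2
  | Let _ e1 e2 => arity x n e1 && arity x.+1 n e2
  | Op _ _ e1 => arity x n e1
  | OpE _ _ _ v E => varity x n v && earity x n E
  | Handle e1 h => arity x n e1 && harity x n h
  | Resume _ e1 => arity x.+1 n e1
  end
with harity (x n : nat) (h : handler) : bool :=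
  match h with
  | HRet e => arity x.+1 n e
  | HOp h1 _ _ e => harity x n h1 && arity x.+1 n e
  end
with earity (x n : nat) (E : ectx) : bool :=
  match E with
  | EHole => true
  | EAppL E1 e2 => earity x n E1 && arity x n e2
  | EAppR v1 E1 => varity x n v1 && earity x n E1
  | EOp _ _ E1 => earity x n E1
  | EHandle E1 h => earity x n E1 && harity x n h
  | ELet _ E1 e2 => earity x n E1 && arity x.+1 n e2
  end.

(* Continuation substitution  e[E / resume]^(forall bs. As)_(/\bs. v):
   bs are [cn] type variables, below which [cargs] and [cval] live. *)
Record cont : Type := Cont {
  cn : nat;
  cargs : seq ty;
  cval : val;
  cctx : ectx
}.

(* Weakening by k type variables and j term variables. *)
Definition cshift (k j : nat) (th : cont) : cont :=
  Cont (cn th)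
       (map (tysub (tup (cn th) (tshift k))) (cargs th))
       (vren (addn j) (vtsub (tup (cn th) (tshift k)) (cval th)))
       (eren (addn j) (etsub (tshift k) (cctx th))).

(* e[As/gs] for e in the scope of gs, placed below the binder of bs. *)
Definition cinst (th : cont) (e : tm) : tm :=
  let m := size (cargs th) in
  tsub (fun a => nth (TVar (cn th + (a - m))) (cargs th) a) e.

Fixpoint vcsub (th : cont) (v : val) : val :=
  match v with
  | Const c => Const c
  | Lam e => Lam (csub (cshift 0 1 th) e)
  end
with csub (th : cont) (e : tm) : tm :=
  match e with
  | Var x As => Var x As
  | Val v => Val (vcsub th v)
  | App e1 e2 => App (csub th e1) (csub th e2)
  | Let n e1 e2 => Let n (csub (cshift n 0 th) e1) (csub (cshift 0 1 th) e2)
  | Op o As e1 => Op o As (csub th e1)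
  | OpE o ss n v E => OpE o ss n (vcsub (cshift n 0 th) v) E
  | Handle e1 h => Handle (csub th e1) (hcsub th h)
  | Resume m e1 =>
      Let (cn th)
          (sub1 0 (cval th) (cinst th (csub (cshift m 1 th) e1)))
          (plug (eren succn (cctx th)) (Var 0 (mkseq TVar (cn th))))
  end
with hcsub (th : cont) (h : handler) : handler :=
  match h with
  | HRet e => HRet (csub (cshift 0 1 th) e)
  | HOp h1 m o e => HOp (hcsub th h1) m o e
  end.

(* [csub] is partial as well: each resume it replaces must bind as many type
   variables as there are types in [cargs], and the value substitution it
   performs must be defined. *)
Fixpoint vcdef (th : cont) (v : val) : bool :=
  match v with
  | Const c => true
  | Lam e => cdef (cshift 0 1 th) e
  end
with cdef (th : cont) (e : tm) : bool :=
  match e with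
  | Var _ _ => true
  | Val v => vcdef th v
  | App e1 e2 => cdef th e1 && cdef th e2
  | Let n e1 e2 => cdef (cshift n 0 th) e1 && cdef (cshift 0 1 th) e2
  | Op _ _ e1 => cdef th e1
  | OpE _ _ n v _ => vcdef (cshift n 0 th) v
  | Handle e1 h => cdef th e1 && hcdef th h
  | Resume m e1 =>
      [&& m == size (cargs th), cdef (cshift m 1 th) e1
        & arity 0 0 (cinst th (csub (cshift m 1 th) e1))]
  end
with hcdef (th : cont) (h : handler) : bool :=
  match h with
  | HRet e => cdef (cshift 0 1 th) e
  | HOp h1 _ _ _ => hcdef th h1
  end.

Fixpoint hret (h : handler) : tm :=
  match h with
  | HRet e => e
  | HOp h1 _ _ _ => hret h1
  end.

Fixpoint ops (h : handler) : effect L :=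
  match h with
  | HRet _ => fset0
  | HOp h1 _ o _ => o |` ops h1
  end.

Fixpoint hop (h : handler) (o : operation L) : option (nat * tm) :=
  match h with
  | HRet _ => None
  | HOp h1 m o' e => if o == o' then Some (m, e) else hop h1 o
  end.

(* A[_|_/bs] for the n type variables bs. *)
Definition bots (n : nat) : nat -> ty := inst (nseq n (TBase (bot L))).

Inductive red : tm -> tm -> Prop :=
  | R_Const c1 c2 c :
      zeta c1 c2 = Some c ->
      red (App (Val (Const c1)) (Val (Const c2))) (Val (Const c))
  | R_Beta e v :
      arity 0 0 e -> red (App (Val (Lam e)) (Val v)) (sub1 0 v e)
  | R_Let n v e :
      arity 0 n e -> red (Let n (Val v) e) (sub1 n v e)
  | R_Return v h :
      arity 0 0 (hret h) -> red (Handle (Val v) h) (sub1 0 v (hret h))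
  | R_Op o As v :
      red (Op o As (Val v)) (OpE o [seq mono A | A <- As] 0 v EHole)
  | R_OpAppL o ss n v E e2 :
      red (App (OpE o ss n v E) e2) (OpE o ss n v (EAppL E e2))
  | R_OpAppR o ss n v E v1 :
      red (App (Val v1) (OpE o ss n v E)) (OpE o ss n v (EAppR v1 E))
  | R_OpOp o ss n v E o' As :
      red (Op o' As (OpE o ss n v E)) (OpE o ss n v (EOp o' As E))
  | R_OpHandle o ss n v E h :
      o \notin ops h ->
      red (Handle (OpE o ss n v E) h) (OpE o ss n v (EHandle E h))
  | R_OpLet m o ss n v E e2 :
      red (Let m (OpE o ss n v E) e2)
          (OpE o [seq (m + s.1, s.2) | s <- ss] (m + n) v (ELet m E e2))
  | R_Handle o ss n v E h m e :
      all (fun s => s.1 == n) ss -> edepth E = n ->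
      hop h o = Some (m, e) -> size ss = m ->
      let As := [seq s.2 | s <- ss] in
      let th := cshift m 1 (Cont n As v (EHandle E h)) in
      let e1 := tsub (inst [seq tysub (bots n) A | A <- As]) (csub th e) in
      cdef th e -> arity 0 0 e1 ->
      red (Handle (OpE o ss n v E) h) (sub1 0 (vtsub (bots n) v) e1).

Inductive step : tm -> tm -> Prop :=
  | Step E e1 e2 : red e1 e2 -> step (plug E e1) (plug E e2).

Definition steps : tm -> tm -> Prop := clos_refl_trans tm step.

Definition is_value (e : tm) : Prop := exists v, e = Val v.

Definition not_stuck (e : tm) : Prop :=
  forall e', steps e e' -> ~ (exists e'', step e' e'') -> is_value e'.

End Intermediate.

Arguments Var {L} _ _.
Arguments EHole {L}.
Arguments bots {L} n a.

Section Elaboration.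
Variable L : language.
Local Notation ty := (lty L).
Local Notation context := (context L).
Local Notation resty := (resty L).

(* The map S sends indices of surface variables to indices of intermediate
   variables.  S o {x |-> x}, for x bound by both terms, is [up_ren S].
   [resume_map k S] is S o {x |-> y} in (Resume), where x (index k) is moved
   to the end of the surface context and y is the variable bound by the
   resume: 0 is mapped to 0, and the other variables as by S. *)
Definition resume_map (k : nat) (S : nat -> nat) : nat -> nat :=
  up_ren (fun z => S (if z < k then z else z.+1)).

Inductive elab : context -> resty -> stm L -> ty -> effect L ->
    (nat -> nat) -> tm L -> Prop :=
  | E_Var G R x n A Bs eff S :
      wf_ctx G -> lookup G x = Some (n, A) ->
      size Bs = n -> all (fun B => in_scope G (mono B)) Bs ->
      elab G R (SVar x) (tysub (inst Bs) A) eff S (Var (S x) Bs)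
  | E_Const G R c eff S :
      wf_ctx G -> elab G R (SConst c) (ty_const c) eff S (Val (Const c))
  | E_Abs G R M A B eff eff' S e :
      elab (ETm (mono A) :: G) (rshift_tm R) M B eff' (up_ren S) e ->
      elab G R (SLam M) (TArr A eff' B) eff S (Val (Lam e))
  | E_App G R M1 M2 A B eff eff' S e1 e2 :
      elab G R M1 (TArr A eff' B) eff S e1 -> elab G R M2 A eff S e2 ->
      eff' `<=` eff ->
      elab G R (SApp M1 M2) B eff S (App e1 e2)
  | E_Let G R M1 M2 n A B eff S e1 e2 :
      elab (tyvars n ++ G) (rshift_ty n R) M1 A eff S e1 ->
      elab (ETm (n, A) :: G) (rshift_tm R) M2 B eff (up_ren S) e2 ->
      elab G R (SLet M1 M2) B eff S (Let n e1 e2)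
  | E_Weak G R M A eff eff' S e :
      elab G R M A eff' S e -> eff' `<=` eff -> elab G R M A eff S e
  | E_Op G R o M n A B Cs eff S e :
      sig o = (n, A, B) -> o \in eff ->
      elab G R M (tysub (inst Cs) A) eff S e ->
      size Cs = n -> all (fun C => in_scope G (mono C)) Cs ->
      elab G R (SOp o M) (tysub (inst Cs) B) eff S (Op o Cs e)
  | E_Handle G R M H A B eff eff' S e h :
      elab G R M A eff S e -> helab G R H A eff B eff' S h ->
      elab G R (SHandle M H) B eff' S (Handle e h)
  | E_Resume G1 G2 D als A B C eff eff' M S e :
      wf_ctx (G2 ++ ETm (mono D) :: G1) -> declared_in G1 G2 als ->
      eff `<=` eff' ->
      elab (resume_ctx G1 G2 als A) (resume_res als A B eff C)
           (sren (to_front (ntm G2)) M) (fresh_copy als B) eff'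
           (resume_map (ntm G2) S) e ->
      elab (G2 ++ ETm (mono D) :: G1) (RSome als (ntm G2) A B eff C)
           (SResume M) C eff' S (Resume (size als) e)
with helab : context -> resty -> shandler L -> ty -> effect L -> ty ->
    effect L -> (nat -> nat) -> handler L -> Prop :=
  | E_HRet G R M A B eff eff' S e :
      elab (ETm (mono A) :: G) (rshift_tm R) M B eff' (up_ren S) e ->
      eff `<=` eff' ->
      helab G R (SHRet M) A eff B eff' S (HRet e)
  | E_HOp G R H o M n A B C D eff eff' S h e :
      helab G R H A eff B eff' S h -> sig o = (n, C, D) ->
      wf_resty (clause_res n C D eff' B) ->
      elab (clause_ctx G n C) (clause_res n C D eff' B)
           M (tysub (tshift n) B) eff' (up_ren S) e ->
      o \notin eff ->
      helab G R (SHOp H o M) A (o |` eff) B eff' S (HOp h n o e).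

End Elaboration.

(* Main.v *)
Require Import Defs.
From mathcomp Require Import all_boot finmap.

Set Implicit Arguments.
Unset Strict Implicit.
Unset Printing Implicit Defensive.

Local Open Scope fset_scope.
Local Open Scope nat_scope.

(* Every well-typed surface term elaborates to a term typed by a syntax-directed
   type system for the intermediate language, whose evaluation enjoys
   preservation and progress; a closed term with the empty effect can be neither
   stuck nor an unhandled operation.  The delicate step is the reduction of a
   handled operation whose continuation generalizes the type variables bs: the
   argument v and the hole of E are typed below bs, and since a clause body is
   polymorphic in the type variables of its operation, each resume body can be
   instantiated below bs and generalized again by the let plugged into E.  The
   rest of the clause uses v at bs := bot only. *)

(** * Type substitutions, their lifting below binders, and their action on schemes *)

Section TypeSubstitution.
Variables (base : Type) (op : choiceType).
Local Notation ty := (ty base op).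
Implicit Types (s t : nat -> ty) (A B : ty) (Bs : seq ty) (sg : scheme base op).

Lemma eq_tysub s t : s =1 t -> tysub s =1 tysub t.
Proof. by move=> st; elim=> //= A -> eff B ->. Qed.

Lemma eq_in_tysub m s t A :
  all (fun a => a < m) (ftv A) -> (forall a, a < m -> s a = t a) ->
  tysub s A = tysub t A.
Proof.
move=> + st; elim: A => //= [a|A IHA eff B IHB]; first by rewrite andbT => /st.
by rewrite all_cat => /andP[/IHA-> /IHB->].
Qed.

Lemma tysub_comp s t A : tysub s (tysub t A) = tysub (tysub s \o t) A.
Proof. by elim: A => //= A -> eff B ->. Qed.

Lemma tysub_id A : tysub TVar A = A.
Proof. by elim: A => //= A -> eff B ->. Qed.

Lemma tysub_closed m s A :
  all (fun a => a < m) (ftv A) -> (forall a, a < m -> s a = TVar a) ->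
  tysub s A = A.
Proof. by move=> cA sE; rewrite (eq_in_tysub cA sE) tysub_id. Qed.

Lemma tysub_tup_shift n s A :
  tysub (tup n s) (tysub (tshift n) A) = tysub (tshift n) (tysub s A).
Proof.
rewrite !tysub_comp; apply: eq_tysub => a /=.
by rewrite /tup ltnNge leq_addr addKn.
Qed.

Lemma tup_comp n s t :
  (tysub (tup n s) \o tup n t) =1 tup n (tysub s \o t).
Proof.
move=> a /=; rewrite {2 3}/tup; case: ltnP => [a_lt /=|_].
  by rewrite /tup a_lt.
exact: tysub_tup_shift.
Qed.

Lemma eq_tup n s t : s =1 t -> tup n s =1 tup n t.
Proof. by move=> st a; rewrite /tup st. Qed.

Lemma tup0 s : tup 0 s =1 s.
Proof. by move=> a; rewrite /tup /= subn0 -[RHS]tysub_id. Qed.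

Lemma tup_TVar n : tup n TVar =1 (TVar : nat -> ty).
Proof.
by move=> a; rewrite /tup; case: ltnP => //= le_na; rewrite /tshift subnKC.
Qed.

Lemma tup_add m n s : tup m (tup n s) =1 tup (m + n) s.
Proof.
move=> a; rewrite /tup; case: ltnP => [lt_am|le_ma].
  by rewrite (leq_trans lt_am (leq_addr _ _)).
rewrite ltn_subLR // subnDA; case: ifP => _ /=.
  by rewrite /tshift subnKC.
by rewrite tysub_comp; apply: eq_tysub => b; rewrite /= /tshift addnA.
Qed.

Lemma inst_shift Bs : tysub (inst Bs) \o tshift (size Bs) =1 TVar.
Proof. by move=> a; rewrite /= /inst nth_default ?leq_addr // addKn. Qed.

Lemma tysub_inst_shift Bs A : tysub (inst Bs) (tysub (tshift (size Bs)) A) = A.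
Proof.
by rewrite tysub_comp -[RHS]tysub_id; apply/eq_tysub/inst_shift.
Qed.

Lemma inst_lt Bs s a :
  a < size Bs -> inst (map (tysub s) Bs) a = tysub s (inst Bs a).
Proof.
by move=> ltaB; rewrite /inst (nth_map (TVar (a - size Bs))).
Qed.

(** On the older variables, the shift inserted by [tup] is undone by the outer instantiation, which
    leaves [s] alone. *)
Lemma tysub_inst s Bs A :
  tysub s (tysub (inst Bs) A)
  = tysub (inst (map (tysub s) Bs)) (tysub (tup (size Bs) s) A).
Proof.
rewrite !tysub_comp; apply: eq_tysub => a /=.
rewrite /tup; case: ltnP => [lt_aB|le_Ba]; first by rewrite /= inst_lt.
by rewrite -(size_map (tysub s)) tysub_inst_shift /inst nth_default ?size_map.
Qed.

(** Meant for operation signatures, which are closed: a substitution acts on their type arguments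
    only, so no lifting of [s] appears. *)
Lemma tysub_inst_closed s Bs A :
  all (fun a => a < size Bs) (ftv A) ->
  tysub s (tysub (inst Bs) A) = tysub (inst (map (tysub s) Bs)) A.
Proof.
by move=> cA; rewrite tysub_inst (tysub_closed cA) // => a; rewrite /tup => ->.
Qed.

Lemma eq_scsub s t : s =1 t -> scsub s =1 scsub t.
Proof. by move=> st sg; rewrite /scsub (eq_tysub (eq_tup _ st)). Qed.

Lemma scsub_comp s t sg : scsub s (scsub t sg) = scsub (tysub s \o t) sg.
Proof.
by rewrite /scsub /= tysub_comp (eq_tysub (tup_comp _ _ _)).
Qed.

Lemma scsub_id sg : scsub TVar sg = sg.
Proof.
by case: sg => n A; rewrite /scsub /= (eq_tysub (tup_TVar _)) tysub_id.
Qed.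

Lemma scsub_mono s A : scsub s (mono A) = mono (tysub s A).
Proof. by rewrite /scsub /mono /= (eq_tysub (tup0 _)). Qed.

Definition shift_ctx n : seq (scheme base op) -> seq (scheme base op) :=
  map (scsub (tshift n)).

Implicit Type D : seq (scheme base op).

Lemma map_scsub_comp s t D :
  map (scsub s) (map (scsub t) D) = map (scsub (tysub s \o t)) D.
Proof. by rewrite -map_comp; apply: eq_map => sg /=; rewrite scsub_comp. Qed.

Lemma shift_ctx0 D : shift_ctx 0 D = D.
Proof.
by rewrite -[RHS]map_id; apply: eq_map => sg; rewrite -[RHS]scsub_id.
Qed.

Lemma shift_ctx_add m n D : shift_ctx m (shift_ctx n D) = shift_ctx (m + n) D.
Proof.
rewrite /shift_ctx map_scsub_comp; apply/eq_map/eq_scsub => a.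
by rewrite /= /tshift addnA.
Qed.

Lemma shift_ctx_tup n s D :
  map (scsub (tup n s)) (shift_ctx n D) = shift_ctx n (map (scsub s) D).
Proof.
rewrite /shift_ctx !map_scsub_comp; apply/eq_map/eq_scsub => a /=.
exact: (tysub_tup_shift n s (TVar a)).
Qed.

Lemma shift_ctx_inst Bs D : map (scsub (inst Bs)) (shift_ctx (size Bs) D) = D.
Proof.
rewrite /shift_ctx map_scsub_comp -[RHS]map_id; apply: eq_map => sg.
by rewrite (eq_scsub (inst_shift Bs)) scsub_id.
Qed.

Lemma onth_map_scsub s D x sg :
  onth D x = Some sg -> onth (map (scsub s) D) x = Some (scsub s sg).
Proof. by rewrite onth_map => ->. Qed.

End TypeSubstitution.

(** * A syntax-directed type system for the intermediate language *)

Section Typing.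
Variable L : language.
Local Notation ty := (lty L).
Local Notation ctx := (seq (lscheme L)).

(* [Some (o, eff, C)] inside a clause for [o] of a handler with result type
   [C] and effect [eff]. *)
Definition res : Type := option (operation L * effect L * ty).

Definition ressub (s : nat -> ty) (R : res) : res :=
  omap (fun r => (r.1, tysub s r.2)) R.

(* Contexts declare only the term variables, as safety does not need type
   variables to be in scope.  Effect weakening is admissible thanks to the slack
   in [TT_App], [TT_Handle] and [TT_Resume].  A suspended operation has no
   resume of its own, hence the [None] in [TT_OpE]. *)
Inductive vtyped : ctx -> res -> Defs.val L -> ty -> Prop :=
  | VT_Const D R c : vtyped D R (Const c) (ty_const c)
  | VT_Lam D R e A B eff :
      ttyped (mono A :: D) R e B eff -> vtyped D R (Lam e) (TArr A eff B)
with ttyped : ctx -> res -> tm L -> ty -> effect L -> Prop :=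
  | TT_Var D R x n A Bs eff :
      onth D x = Some (n, A) -> size Bs = n ->
      ttyped D R (Var x Bs) (tysub (inst Bs) A) eff
  | TT_Val D R v A eff : vtyped D R v A -> ttyped D R (Val v) A eff
  | TT_App D R e1 e2 A B eff eff' :
      ttyped D R e1 (TArr A eff' B) eff -> ttyped D R e2 A eff ->
      eff' `<=` eff -> ttyped D R (App e1 e2) B eff
  | TT_Let D R n e1 e2 A B eff :
      ttyped (shift_ctx n D) (ressub (tshift n) R) e1 A eff ->
      ttyped ((n, A) :: D) R e2 B eff ->
      ttyped D R (Let n e1 e2) B eff
  | TT_Op D R o n A B Cs e eff :
      sig o = (n, A, B) -> o \in eff -> size Cs = n ->
      ttyped D R e (tysub (inst Cs) A) eff ->
      ttyped D R (Op o Cs e) (tysub (inst Cs) B) eff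
  | TT_OpE D R o m A B Cs n v E C eff :
      sig o = (m, A, B) -> o \in eff -> size Cs = m -> edepth E = n ->
      vtyped (shift_ctx n D) None v (tysub (inst Cs) A) ->
      etyped D E (tysub (inst Cs) B) C eff ->
      ttyped D R (OpE o (map (pair n) Cs) n v E) C eff
  | TT_Handle D R e h A B eff eff' eff'' :
      ttyped D R e A eff -> htyped D R h A eff B eff' -> eff' `<=` eff'' ->
      ttyped D R (Handle e h) B eff''
  | TT_Resume D o eff C m A B e eff' :
      sig o = (m, A, B) -> eff `<=` eff' ->
      ttyped (mono A :: shift_ctx m D)
             (Some (o, eff, tysub (tshift m) C)) e B eff' ->
      ttyped D (Some (o, eff, C)) (Resume m e) C eff'
with htyped :
    ctx -> res -> handler L -> ty -> effect L -> ty -> effect L -> Prop :=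
  | HT_Ret D R e A B eff eff' :
      ttyped (mono A :: D) R e B eff' -> eff `<=` eff' ->
      htyped D R (HRet e) A eff B eff'
  | HT_Op D R h m o e A B A' B' eff eff' :
      htyped D R h A eff B eff' -> sig o = (m, A', B') ->
      ttyped (mono A' :: shift_ctx m D)
             (Some (o, eff', tysub (tshift m) B)) e (tysub (tshift m) B) eff' ->
      htyped D R (HOp h m o e) A (o |` eff) B eff'
(* In [etyped D E A B eff], the type A of the hole lives below the [edepth E]
   type variables bound by E. *)
with etyped : ctx -> ectx L -> ty -> ty -> effect L -> Prop :=
  | ET_Hole D A eff : etyped D EHole A A eff
  | ET_AppL D E e2 A B C eff eff' :
      etyped D E A (TArr B eff' C) eff -> ttyped D None e2 B eff ->
      eff' `<=` eff -> etyped D (EAppL E e2) A C eff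
  | ET_AppR D v1 E A B C eff eff' :
      vtyped D None v1 (TArr B eff' C) -> etyped D E A B eff ->
      eff' `<=` eff -> etyped D (EAppR v1 E) A C eff
  | ET_Op D o n A B Cs E A' eff :
      sig o = (n, A, B) -> o \in eff -> size Cs = n ->
      etyped D E A' (tysub (inst Cs) A) eff ->
      etyped D (EOp o Cs E) A' (tysub (inst Cs) B) eff
  | ET_Handle D E h A B C eff eff' eff'' :
      etyped D E A B eff -> htyped D None h B eff C eff' -> eff' `<=` eff'' ->
      etyped D (EHandle E h) A C eff''
  | ET_Let D n E e2 A B C eff :
      etyped (shift_ctx n D) E A B eff ->
      ttyped ((n, B) :: D) None e2 C eff ->
      etyped D (ELet n E e2) A C eff.

(* Effect weakening, change of resumption type, renaming and type substitution *)
Scheme vtyped_mut := Minimality for vtyped Sort Prop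
  with ttyped_mut := Minimality for ttyped Sort Prop
  with htyped_mut := Minimality for htyped Sort Prop
  with etyped_mut := Minimality for etyped Sort Prop.
Combined Scheme typed_mut from vtyped_mut, ttyped_mut, htyped_mut, etyped_mut.

Lemma sig_closedP (o : operation L) n A B (Cs : seq ty) :
  sig o = (n, A, B) -> size Cs = n ->
  all (fun a => a < size Cs) (ftv A) /\ all (fun a => a < size Cs) (ftv B).
Proof. by move=> /sig_closed + ->; rewrite all_cat => /andP. Qed.

Lemma le_eff_trans (x y z : effect L) : x `<=` y -> y `<=` z -> x `<=` z.
Proof. exact: fsubset_trans. Qed.

(** Nothing is claimed of values, which carry no effect, nor of handlers: the slack in [TT_Handle]
    and [ET_Handle] absorbs the larger effect. *)
Lemma typed_eff :
  (forall D R v A, vtyped D R v A -> True) /\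
  (forall D R e A eff, ttyped D R e A eff ->
     forall eff1, eff `<=` eff1 -> ttyped D R e A eff1) /\
  (forall D R h A eff B eff', htyped D R h A eff B eff' -> True) /\
  (forall D E A B eff, etyped D E A B eff ->
     forall eff1, eff `<=` eff1 -> etyped D E A B eff1).
Proof.
apply: typed_mut => //; try by move=> *; econstructor; eauto using le_eff_trans.
- move=> D R o n A B Cs e eff oE oeff sz _ IH eff1 le1.
  by apply: TT_Op oE _ sz (IH _ le1); apply: (fsubsetP le1).
- move=> D R o m A B Cs n v E C eff oE oeff sz dE vT _ _ IH eff1 le1.
  by apply: TT_OpE oE _ sz dE vT (IH _ le1); apply: (fsubsetP le1).
- move=> D o n A B Cs E A' eff oE oeff sz _ IH eff1 le1.
  by apply: ET_Op oE _ sz (IH _ le1); apply: (fsubsetP le1).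
Qed.

Definition ttyped_eff := proj1 (proj2 typed_eff).

(** A derivation at [None] has resumes only inside operation clauses, which set their own resumption
    type. Substituted values, typed at [None], can thus be placed under any [R]. *)
Lemma typed_res :
  (forall D R v A, vtyped D R v A -> R = None -> forall R', vtyped D R' v A) /\
  (forall D R e A eff, ttyped D R e A eff -> R = None ->
     forall R', ttyped D R' e A eff) /\
  (forall D R h A eff B eff', htyped D R h A eff B eff' -> R = None ->
     forall R', htyped D R' h A eff B eff') /\
  (forall D E A B eff, etyped D E A B eff -> True).
Proof.
apply: typed_mut => //; try by move=> *; econstructor; eauto.
by move=> D R n e1 e2 A B eff _ IH1 _ IH2 R0 R'; subst R; econstructor; eauto.
Qed.

Definition ren_ok (D D' : ctx) (r : nat -> nat) :=
  forall x sg, onth D x = Some sg -> onth D' (r x) = Some sg.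

Lemma ren_ok_cons D D' r sg :
  ren_ok D D' r -> ren_ok (sg :: D) (sg :: D') (up_ren r).
Proof. by move=> ok [|x] //= sg'; apply: ok. Qed.

Lemma ren_ok_map D D' r s :
  ren_ok D D' r -> ren_ok (map (scsub s) D) (map (scsub s) D') r.
Proof.
move=> ok x sg; rewrite onth_map; case Dx: (onth D x) => [sg'|] //= <-.
by rewrite onth_map (ok _ _ Dx).
Qed.
Lemma ren_ok_shift D D' r n :
  ren_ok D D' r -> ren_ok (shift_ctx n D) (shift_ctx n D') r.
Proof. exact: ren_ok_map. Qed.
#[local] Hint Resolve ren_ok_cons ren_ok_shift : core.

Lemma edepth_ren r E : edepth (@eren L r E) = edepth E.
Proof. by elim: E => //= n E ->. Qed.

Lemma typed_ren :
  (forall D R v A, vtyped D R v A -> forall D' r, ren_ok D D' r ->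
     vtyped D' R (vren r v) A) /\
  (forall D R e A eff, ttyped D R e A eff -> forall D' r, ren_ok D D' r ->
     ttyped D' R (tren r e) A eff) /\
  (forall D R h A eff B eff', htyped D R h A eff B eff' ->
     forall D' r, ren_ok D D' r -> htyped D' R (hren r h) A eff B eff') /\
  (forall D E A B eff, etyped D E A B eff -> forall D' r, ren_ok D D' r ->
     etyped D' (eren r E) A B eff).
Proof.
by apply: typed_mut; move=> *; econstructor; rewrite ?edepth_ren; eauto.
Qed.

Lemma ressub_tup n s R :
  ressub (tup n s) (ressub (tshift n) R) = ressub (tshift n) (ressub s R).
Proof. by case: R => [[r C]|] //=; rewrite tysub_tup_shift. Qed.

Lemma edepth_tsub s E : edepth (@etsub L s E) = edepth E.
Proof. by elim: E s => //= n E IH e s; rewrite IH. Qed.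

Definition vtyped_ren := proj1 typed_ren.
Definition etyped_ren := proj2 (proj2 (proj2 typed_ren)).

Lemma tysub_tup_sig s (o : operation L) m A B :
  sig o = (m, A, B) -> tysub (tup m s) A = A /\ tysub (tup m s) B = B.
Proof.
move/sig_closed; rewrite all_cat => /andP[cA cB].
by split; [apply: tysub_closed cA _ | apply: tysub_closed cB _]
  => a; rewrite /tup => ->.
Qed.

Lemma typed_tsub :
  (forall D R v A, vtyped D R v A -> forall s,
     vtyped (map (scsub s) D) (ressub s R) (vtsub s v) (tysub s A)) /\
  (forall D R e A eff, ttyped D R e A eff -> forall s,
     ttyped (map (scsub s) D) (ressub s R) (tsub s e) (tysub s A) eff) /\
  (forall D R h A eff B eff', htyped D R h A eff B eff' -> forall s,
     htyped (map (scsub s) D) (ressub s R) (htsub s h)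
            (tysub s A) eff (tysub s B) eff') /\
  (forall D E A B eff, etyped D E A B eff -> forall s,
     etyped (map (scsub s) D) (etsub s E)
            (tysub (tup (edepth E) s) A) (tysub s B) eff).
Proof.
apply: typed_mut => /=.
(* First-order types contain no type variables. *)
- move=> D R c s; suff -> : tysub s (ty_const c) = ty_const c by constructor.
  by elim: (ty_const_fo c) => //= i A _ ->.
- move=> D R e A B eff _ /= IH s; constructor.
  by rewrite -scsub_mono; apply: IH.
- move=> D R x n A Bs eff Dx szB s; rewrite tysub_inst.
  apply: TT_Var; last by rewrite size_map.
  by rewrite szB; apply: onth_map_scsub Dx.
- by move=> *; constructor; eauto.
- by move=> *; econstructor; eauto.
- move=> D R n e1 e2 A B eff _ IH1 _ IH2 s; econstructor; last exact: IH2.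
  by rewrite -shift_ctx_tup -ressub_tup; apply: IH1.
- move=> D R o n A B Cs e eff oE oeff szC _ IH s.
  have [cA cB] := sig_closedP oE szC.
  rewrite tysub_inst_closed //; apply: TT_Op oE oeff _ _; rewrite ?size_map //.
  by rewrite -tysub_inst_closed //; apply: IH.
- move=> D R o m A B Cs n v E C eff oE oeff szC dE _ IHv _ IHE s.
  have [cA cB] := sig_closedP oE szC.
  have -> : [seq scsub s i | i <- [seq (n, i) | i <- Cs]]
            = [seq (n, i) | i <- [seq tysub (tup n s) C | C <- Cs]].
    by rewrite -!map_comp; apply: eq_map.
  apply: TT_OpE oE oeff _ _ _ _; rewrite ?size_map ?edepth_tsub //.
    by rewrite -shift_ctx_tup -tysub_inst_closed //; apply: IHv.
  by rewrite -tysub_inst_closed // -dE; apply: IHE.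
- by move=> *; econstructor; eauto.
- move=> D o eff C m A B e eff' oE le_eff _ IH s.
  have [tA tB] := tysub_tup_sig s oE.
  apply: TT_Resume oE le_eff _; rewrite -shift_ctx_tup -tysub_tup_shift.
  by move: (IH (tup m s)); rewrite /= scsub_mono tA ?tB.
- move=> D R e A B eff eff' _ IH le_eff s; constructor=> //.
  by rewrite -scsub_mono; apply: IH.
- move=> D R h m o e A B A' B' eff eff' _ IHh oE _ IH s.
  have [tA tB] := tysub_tup_sig s oE.
  apply: HT_Op (IHh s) oE _; rewrite -shift_ctx_tup -tysub_tup_shift.
  by move: (IH (tup m s)); rewrite /= scsub_mono tA ?tB.
- by move=> D A eff s; rewrite (eq_tysub (tup0 s)); constructor.
- by move=> *; econstructor; eauto.
- move=> D v1 E A B C eff eff' _ IH1 _ IH2 le_eff s.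
  by econstructor; eauto; apply: IH1.
- move=> D o n A B Cs E A' eff oE oeff szC _ IH s.
  have [cA cB] := sig_closedP oE szC.
  rewrite tysub_inst_closed //; apply: ET_Op oE oeff _ _; rewrite ?size_map //.
  by rewrite -tysub_inst_closed //; apply: IH.
- move=> D E h A B C eff eff' eff'' _ IHE _ IHh le_eff s.
  by econstructor; eauto; apply: IHh.
- move=> D n E e2 A B C eff _ IHE _ IH2 s; econstructor; last exact: IH2.
  (* The hole lies below the variables of the let and then those of [E]; the two liftings merge into
     one, with the inner variables first. *)
  rewrite -shift_ctx_tup addnC -(eq_tysub (tup_add _ _ _)); exact: IHE.
Qed.

Definition vtyped_tsub := proj1 typed_tsub.
Definition ttyped_tsub := proj1 (proj2 typed_tsub).
Definition etyped_tsub := proj2 (proj2 (proj2 typed_tsub)).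

(** * Substitution of polymorphic values, and why it is defined on typed terms *)

Definition atom_typed (D : ctx) (a : atom L) (sg : lscheme L) : Prop :=
  match a with
  | AVar y => onth D y = Some sg
  | AVal n v => n = sg.1 /\ vtyped (shift_ctx n D) None v sg.2
  end.

Definition sub_ok (D D' : ctx) (s : nat -> atom L) :=
  forall x sg, onth D x = Some sg -> atom_typed D' (s x) sg.

Lemma ren_ok_succ sg D : ren_ok D (sg :: D) succn.
Proof. by []. Qed.

Lemma sub_ok_up_tm D D' s sg :
  sub_ok D D' s -> sub_ok (sg :: D) (sg :: D') (up_tm s).
Proof.
move=> ok [|x] //= sg' /ok; case: (s x) => //= n v [nE vT]; split=> //.
by apply: vtyped_ren vT _ _ _; apply: ren_ok_shift.
Qed.

Lemma sub_ok_up_ty D D' s k :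
  sub_ok D D' s -> sub_ok (shift_ctx k D) (shift_ctx k D') (up_ty k s).
Proof.
move=> ok x sg; rewrite onth_map; case Dx: (onth D x) => [sg'|] //= [<-].
move: (ok _ _ Dx); rewrite /up_ty; case: (s x) => [y|n v] /=.
  by move/onth_map_scsub; apply.
move=> [nE vT]; split=> //; rewrite -shift_ctx_tup -nE.
exact: vtyped_tsub vT _.
Qed.
#[local] Hint Resolve sub_ok_up_tm sub_ok_up_ty : core.

Lemma edepth_sub s E : edepth (@esub L s E) = edepth E.
Proof. by elim: E s => //= n E IH e s; rewrite IH. Qed.

Lemma typed_sub :
  (forall D R v A, vtyped D R v A -> forall D' s, sub_ok D D' s ->
     vtyped D' R (vsub s v) A) /\
  (forall D R e A eff, ttyped D R e A eff -> forall D' s, sub_ok D D' s ->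
     ttyped D' R (sub s e) A eff) /\
  (forall D R h A eff B eff', htyped D R h A eff B eff' ->
     forall D' s, sub_ok D D' s -> htyped D' R (hsub s h) A eff B eff') /\
  (forall D E A B eff, etyped D E A B eff -> forall D' s, sub_ok D D' s ->
     etyped D' (esub s E) A B eff).
Proof.
apply: typed_mut;
  try by move=> *; econstructor; rewrite ?edepth_sub; eauto.
move=> D R x n A Bs eff Dx szB D' s /(_ _ _ Dx) /=.
case: (s x) => [y Dy|_ v [/= -> vT]]; first exact: TT_Var Dy szB.
(* The value is typed at [None], hence at [R]; instantiating its binders by [Bs] also undoes the
   shift of [D']. *)
constructor; apply: (proj1 typed_res) (erefl _) R.
by rewrite -(shift_ctx_inst Bs D') szB; apply: vtyped_tsub vT _.
Qed.

Lemma sub1_typed D R n v e A B eff :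
  ttyped ((n, A) :: D) R e B eff -> vtyped (shift_ctx n D) None v A ->
  ttyped D R (sub1 n v e) B eff.
Proof.
move=> eT vT; apply: (proj1 (proj2 typed_sub)) eT _ _ _ => [[|x]] //= sg.
by case=> <-.
Qed.

(** Typing an occurrence of a variable forces as many type arguments as its scheme quantifies. This
    discharges the [arity] conditions of reduction and of [cdef]. *)
Lemma arity_typed :
  (forall D R v A, vtyped D R v A -> forall x n C, onth D x = Some (n, C) ->
     varity x n v) /\
  (forall D R e A eff, ttyped D R e A eff -> forall x n C,
     onth D x = Some (n, C) -> arity x n e) /\
  (forall D R h A eff B eff', htyped D R h A eff B eff' ->
     forall x n C, onth D x = Some (n, C) -> harity x n h) /\
  (forall D E A B eff, etyped D E A B eff -> forall x n C,
     onth D x = Some (n, C) -> earity x n E).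
Proof.
have shiftP D k x n C : onth D x = Some (n, C) ->
    onth (shift_ctx k D) x = Some (n, tysub (tup n (tshift k)) C).
  exact: onth_map_scsub.
apply: typed_mut => //=;
  try by move=> *; try (apply/andP; split); eauto.
move=> D _ x n A Bs _ Dx szB y k C Dy; apply/implyP => /eqP xy.
by move: Dy; rewrite -xy Dx szB => -[-> _].
Qed.

Definition ttyped_arity := proj1 (proj2 arity_typed).

(** * Typing of the continuation substitution *)

(* At [None] there is no resume to replace, whatever [th] is. *)
Definition cont_typed (R : res) (D : ctx) (th : cont L) : Prop :=
  if R is Some (o, eff, C) then
    exists m A B,
      [/\ sig o = (m, A, B), size (cargs th) = m, edepth (cctx th) = cn th,
          vtyped (shift_ctx (cn th) D) None (cval th)
                 (tysub (inst (cargs th)) A)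
        & etyped D (cctx th) (tysub (inst (cargs th)) B) C eff]
  else True.

Arguments cont_typed : simpl never.

(** One statement covers both kinds of weakening because a resume binds type variables and a term
    variable together. The signature is closed, so only [cargs] is shifted in the types involved. *)
Lemma cont_typed_shift R D D' th k j :
  cont_typed R D th -> ren_ok (shift_ctx k D) D' (addn j) ->
  cont_typed (ressub (tshift k) R) D' (cshift k j th).
Proof.
rewrite /cont_typed; case: R => [[[o eff] C]|] //=.
move=> [m [A [B [oE szA dE vT ET]]]] ok.
have [cA cB] := sig_closedP oE szA.
exists m, A, B; split; rewrite ?size_map ?edepth_ren ?edepth_tsub //.
  rewrite -tysub_inst_closed //.
  apply: (vtyped_ren _ (ren_ok_shift ok)).
  by rewrite -shift_ctx_tup; apply: vtyped_tsub vT _.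
rewrite -tysub_inst_closed //; apply: (etyped_ren _ ok).
by rewrite -dE; apply: etyped_tsub ET _.
Qed.

Lemma cont_typed_lam R D th sg :
  cont_typed R D th -> cont_typed R (sg :: D) (cshift 0 1 th).
Proof.
move=> /(cont_typed_shift (D' := sg :: D) (k := 0) (j := 1)).
rewrite shift_ctx0; have -> : ressub (tshift 0) R = R.
  by case: R => [[r C]|] //=; rewrite tysub_id.
by apply.
Qed.

Lemma cont_typed_ty R D th k :
  cont_typed R D th ->
  cont_typed (ressub (tshift k) R) (shift_ctx k D) (cshift k 0 th).
Proof. by move=> thT; apply: cont_typed_shift thT _. Qed.

(** [etyped] does not record the effect at the hole, which handlers in [E] may change, so the
    plugged term must have every effect. A variable, which is what replacing a resume plugs in,
    does. *)
Lemma plug_typed D E A B eff e :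
  etyped D E A B eff ->
  (forall eff1, ttyped (shift_ctx (edepth E) D) None e A eff1) ->
  ttyped D None (plug E e) B eff.
Proof.
move=> ET; elim: {D E A B eff} ET e => /=;
  try by move=> *; econstructor; eauto; econstructor; eauto.
- by move=> D A eff e /(_ eff); rewrite shift_ctx0.
- move=> D n E e2 A B C eff _ IH e2T e eT; econstructor; last exact: e2T.
  by apply: IH => eff1; rewrite shift_ctx_add addnC.
Qed.

(** A variable whose scheme generalizes bs over [A], used at bs below another binder of bs, has type
    [A] again. *)
Lemma tysub_inst_id n A :
  tysub (inst (mkseq TVar n)) (tysub (tup n (tshift n)) A) = A :> ty.
Proof.
rewrite tysub_comp -[RHS]tysub_id; apply: eq_tysub => a /=; rewrite /tup.
case: ltnP => lt_an /=; first by rewrite /inst nth_mkseq.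
by rewrite /inst nth_default size_mkseq ?leq_addr // /tshift addKn subnKC.
Qed.

(** Definedness and typing are proved together: the arity test at a resume concerns its body after
    the recursive substitution, and follows from the typing of that body. *)
Lemma typed_csub :
  (forall D R v A, vtyped D R v A -> forall th, cont_typed R D th ->
     vcdef th v /\ vtyped D None (vcsub th v) A) /\
  (forall D R e A eff, ttyped D R e A eff -> forall th, cont_typed R D th ->
     cdef th e /\ ttyped D None (csub th e) A eff) /\
  (forall D R h A eff B eff', htyped D R h A eff B eff' ->
     forall th, cont_typed R D th ->
     hcdef th h /\ htyped D None (hcsub th h) A eff B eff') /\
  (forall D E A B eff, etyped D E A B eff -> True).
Proof.
apply: typed_mut => //=; try by move=> *; split=> //; econstructor; eauto.
- move=> D R e A B eff _ IH th /(cont_typed_lam (mono A)) /IH [def eT].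
  by split=> //; constructor.
- by move=> D R v A eff _ IH th /IH [def vT]; split=> //; constructor.
- move=> D R e1 e2 A B eff eff' _ IH1 _ IH2 le_eff th thT.
  have [-> e1T] := IH1 _ thT; have [-> e2T] := IH2 _ thT.
  by split=> //; econstructor; eauto.
- move=> D R n e1 e2 A B eff _ IH1 _ IH2 th thT.
  have [-> e1T] := IH1 _ (cont_typed_ty n thT).
  have [-> e2T] := IH2 _ (cont_typed_lam (n, A) thT).
  by split=> //; econstructor; eauto.
- move=> D R o n A B Cs e eff oE oeff szC _ IH th /IH [def eT].
  by split=> //; econstructor; eauto.
- move=> D R o m A B Cs n v E C eff oE oeff szC dE _ IHv ET _ th thT.
  (* A suspended operation has its value typed at [None], where [cont_typed] is [True]. *)
  have [-> vT] := IHv (cshift n 0 th) I.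
  by split=> //; econstructor; eauto.
- move=> D R e h A B eff eff' eff'' _ IHe _ IHh le_eff th thT.
  have [-> eT] := IHe _ thT; have [-> hT] := IHh _ thT.
  by split=> //; econstructor; eauto.
- move=> D o eff C m A B e eff' oE le_eff _ IH th thT.
  have [] := IH (cshift m 1 th).
    exact: (cont_typed_shift (R := Some (o, eff, C)) thT).
  move=> -> eT.
  have [m' [A' [B' []]]] := thT.
  rewrite oE => -[<- <- <-] szA dE vT ET.
  have {}eT : ttyped (mono (tysub (inst (cargs th)) A) :: shift_ctx (cn th) D)
      None (cinst th (csub (cshift m 1 th) e)) (tysub (inst (cargs th)) B) eff'.
    have := sig_closedP oE szA; rewrite szA => -[cA cB].
    rewrite /cinst; set t := fun a => nth _ _ a.
    (* [t] and [inst] differ only in their defaults: the result is placed below bs, so [t] shifts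
       the older variables by [cn th]. *)
    have tE a : a < m -> t a = inst (cargs th) a.
      by move=> lt_am; apply: set_nth_default; rewrite szA.
    have -> : shift_ctx (cn th) D = map (scsub t) (shift_ctx m D).
      rewrite /shift_ctx map_scsub_comp; apply/eq_map/eq_scsub => a.
      by rewrite /= /t nth_default ?szA ?leq_addr // addKn.
    rewrite -(eq_in_tysub cA tE) -(eq_in_tysub cB tE) -/(mono _) -scsub_mono.
    exact: (ttyped_tsub eT t).
  split.
    by rewrite szA eqxx; apply: ttyped_arity eT _ _ _ _.
  econstructor.
    apply: sub1_typed eT _; rewrite shift_ctx0; exact: vT.
  apply: (ttyped_eff _ le_eff); apply: plug_typed; first exact: (etyped_ren ET (@ren_ok_succ _ _)).
  move=> eff1; set B1 := tysub _ B.
  (* The let-bound variable, generalized over bs, is instantiated at the bs bound by the context, as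
     its hole expects. *)
  rewrite edepth_ren dE /= -{2}(tysub_inst_id (cn th) B1).
  by apply: TT_Var; rewrite ?size_mkseq.
- move=> D R e A B eff eff' _ IH le_eff th.
  by move=> /(cont_typed_lam (mono A)) /IH [-> eT]; split=> //; constructor.
- move=> D R h m o e A B A' B' eff eff' _ IHh oE eT _ th /IHh [-> hT].
  by split=> //; econstructor; eauto.
Qed.

Definition ttyped_csub := proj1 (proj2 typed_csub).

(** * Handler clauses, inversion of typing and canonical forms *)

Lemma hret_typed D R h A eff B eff' :
  htyped D R h A eff B eff' -> ttyped (mono A :: D) R (hret h) B eff'.
Proof. by elim. Qed.

Lemma hop_typed D R h A eff B eff' o m e :
  htyped D R h A eff B eff' -> hop h o = Some (m, e) ->
  exists A' B', sig o = (m, A', B') /\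
    ttyped (mono A' :: shift_ctx m D)
           (Some (o, eff', tysub (tshift m) B)) e (tysub (tshift m) B) eff'.
Proof.
elim=> // {}D {}R h1 m1 o1 e1 {}A {}B A' B' {}eff {}eff' _ IH oE eT /=.
by case: eqVneq => [->|_ /IH //] [<- <-]; exists A', B'.
Qed.

Lemma hop_ops (h : handler L) o :
  o \in ops h -> exists m e, hop h o = Some (m, e).
Proof.
elim: h => [e|h IH m o' e] /=; first by rewrite in_fset0.
by rewrite in_fset1U; case: eqP => //= _ _; exists m, e.
Qed.

(** The effect of the handled term is that of the return clause, contained in [eff'], plus the
    operations of the clauses. *)
Lemma ops_unhandled D R h A eff B eff' o :
  htyped D R h A eff B eff' -> o \in eff -> o \notin ops h -> o \in eff'.
Proof.
elim=> [{}D {}R e {}A {}B {}eff {}eff' _ /fsubsetP le_eff /le_eff //|].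
move=> {}D {}R h1 m o' e {}A {}B A' B' {}eff {}eff' _ IH _ _ /=.
by rewrite !in_fset1U; case: eqP.
Qed.

Lemma fo_ty_const (c : Defs.constant L) A eff B :
  ty_const c = TArr A eff B -> exists2 i, A = TBase i & eff = fset0.
Proof.
by move=> cE; have := ty_const_fo c; rewrite cE => F; inversion F; exists i.
Qed.

(** The schemes are given up to an equation, since those of a reduct need not have the syntactic
    form [map (pair n) Cs]. *)
Lemma ttyped_OpE_intro D R o m A B (Cs : seq ty) ss n v E C eff :
  sig o = (m, A, B) -> o \in eff -> size Cs = m -> edepth E = n ->
  ss = map (pair n) Cs ->
  vtyped (shift_ctx n D) None v (tysub (inst Cs) A) ->
  etyped D E (tysub (inst Cs) B) C eff ->
  ttyped D R (OpE o ss n v E) C eff.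
Proof.
by move=> oE oeff szC dE -> vT ET; apply: TT_OpE oE oeff szC dE vT ET.
Qed.

Lemma ttyped_Val D R v A eff : ttyped D R (Val v) A eff -> vtyped D R v A.
Proof. by inversion 1. Qed.

Lemma ttyped_App D R e1 e2 B eff : ttyped D R (App e1 e2) B eff ->
  exists A eff', [/\ ttyped D R e1 (TArr A eff' B) eff, ttyped D R e2 A eff
                   & eff' `<=` eff].
Proof. by inversion 1; do 2!eexists; split; eauto. Qed.

Lemma ttyped_Let D R n e1 e2 B eff : ttyped D R (Let n e1 e2) B eff ->
  exists2 A, ttyped (shift_ctx n D) (ressub (tshift n) R) e1 A eff
           & ttyped ((n, A) :: D) R e2 B eff.
Proof. by inversion 1; subst; eexists; eauto. Qed.

Lemma ttyped_Op D R o Cs e C eff : ttyped D R (Op o Cs e) C eff ->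
  exists A B, [/\ sig o = (size Cs, A, B), o \in eff, C = tysub (inst Cs) B
                & ttyped D R e (tysub (inst Cs) A) eff].
Proof. by inversion 1; subst; do 2!eexists; split; eauto. Qed.

Lemma ttyped_OpE D R o ss n v E C eff : ttyped D R (OpE o ss n v E) C eff ->
  exists A B Cs,
    [/\ sig o = (size Cs, A, B) /\ o \in eff, edepth E = n,
        ss = map (pair n) Cs,
        vtyped (shift_ctx n D) None v (tysub (inst Cs) A)
      & etyped D E (tysub (inst Cs) B) C eff].
Proof. by inversion 1; subst; do 3!eexists; split; eauto. Qed.

Lemma ttyped_Handle D R e h B eff : ttyped D R (Handle e h) B eff ->
  exists A eff1 eff2, [/\ ttyped D R e A eff1, htyped D R h A eff1 B eff2
                        & eff2 `<=` eff].
Proof. by inversion 1; subst; do 3!eexists; split; eauto. Qed.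

(** Canonical forms at arrow types. The base argument type in the constant case comes from
    first-orderness, and is what [zeta_defined] asks for. *)
Lemma vtyped_TArr D R v A eff B : vtyped D R v (TArr A eff B) ->
  (exists2 e, v = Lam e & ttyped (mono A :: D) R e B eff) \/
  (exists i c, [/\ v = Const c, ty_const c = TArr (TBase i) fset0 B,
                 A = TBase i & eff = fset0]).
Proof.
move TE: (TArr A eff B) => T vT; case: vT TE => {D R v T} [D R c /esym cE|].
  by have [i Ai effi] := fo_ty_const cE; subst; right; exists i, c.
by move=> D R e A1 B1 eff1 eT [-> -> ->]; left; exists e.
Qed.

Lemma vtyped_Const D R c A : vtyped D R (Const c) A -> A = ty_const c.
Proof. by inversion 1. Qed.

(** The core of a handled operation, shared by preservation, which uses the typing, and progress,
    which also uses the side conditions of [R_Handle]. *)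
Lemma clause_typed D o A B Cs n v E h A' C eff eff' m e :
  sig o = (size Cs, A, B) -> edepth E = n ->
  vtyped (shift_ctx n D) None v (tysub (inst Cs) A) ->
  etyped D E (tysub (inst Cs) B) A' eff ->
  htyped D None h A' eff C eff' -> hop h o = Some (m, e) ->
  let th := cshift m 1 (Cont n Cs v (EHandle E h)) in
  [/\ size Cs = m, cdef th e
    & ttyped (mono (tysub (bots n) (tysub (inst Cs) A)) :: D) None
        (tsub (inst [seq tysub (bots n) A | A <- Cs]) (csub th e)) C eff'].
Proof.
move=> oE dE vT ET hT hE th.
have [A1 [B1 []]] := hop_typed hT hE; rewrite oE => -[szC <- _] eT.
have thT : cont_typed (Some (o, eff', tysub (tshift m) C))
    (mono A :: shift_ctx m D) th.
  apply: (cont_typed_shift (R := Some (o, eff', C)) (D := D)) => //.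
  (* The handler is reinstalled around [E], so the continuation has the result type and effect that
     a resume promises. *)
  by exists m, A, B; split; rewrite ?oE ?szC //; apply: ET_Handle ET hT _.
have [def {}eT] := ttyped_csub eT thT.
split=> //; have [cA _] := sig_closedP oE (erefl _).
rewrite tysub_inst_closed //.
(* The type variables of the clause become the arguments at bs := bot; [D] and [C] were only shifted
   past them and come back unchanged. *)
have := ttyped_tsub eT (inst [seq tysub (bots n) C | C <- Cs]).
rewrite /= scsub_mono -szC -(size_map (tysub (bots n))).
by rewrite shift_ctx_inst tysub_inst_shift.
Qed.

(** * Preservation *)

Lemma red_typed e e' : red e e' -> forall D A eff,
  ttyped D None e A eff -> ttyped D None e' A eff.
Proof.
case=> {e e'}.
- move=> c1 c2 c zE D B eff.
  move=> /ttyped_App[A [eff' [/ttyped_Val c1T /ttyped_Val c2T _]]].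
  case: (vtyped_TArr c1T) => [[]//|[i [_ [[<-] c1E AE _]]]].
  have c2E := vtyped_Const c2T; rewrite AE in c2E.
  by rewrite -(zeta_ty zE c1E (esym c2E)); do 2!constructor.
- move=> e v _ D B eff.
  move=> /ttyped_App[A [eff' [/ttyped_Val eT /ttyped_Val vT le_eff]]].
  case: (vtyped_TArr eT) => [[_ [<-] {}eT]|[? [? []//]]].
  by apply: (ttyped_eff _ le_eff); apply: sub1_typed eT _; rewrite shift_ctx0.
- move=> n v e _ D B eff /ttyped_Let[A /ttyped_Val vT eT].
  exact: sub1_typed eT vT.
- move=> v h _ D B eff.
  move=> /ttyped_Handle[A [eff1 [eff2 [/ttyped_Val vT hT le_eff]]]].
  apply: (ttyped_eff _ le_eff); apply: sub1_typed (hret_typed hT) _.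
  by rewrite shift_ctx0.
- move=> o Cs v D _ eff /ttyped_Op[A [B [oE oeff -> /ttyped_Val vT]]].
  apply: (ttyped_OpE_intro _ oE oeff) => //; last exact: ET_Hole.
  by rewrite shift_ctx0.
- move=> o ss n v E e2 D C eff /ttyped_App[A' [eff' [+ e2T le_eff]]].
  move=> /ttyped_OpE[A [B [Cs [[oE oeff] dE -> vT ET]]]].
  by apply: TT_OpE oE oeff _ _ vT _ => //; apply: ET_AppL ET e2T le_eff.
- move=> o ss n v E v1 D C eff.
  move=> /ttyped_App[A' [eff' [/ttyped_Val v1T + le_eff]]].
  move=> /ttyped_OpE[A [B [Cs [[oE oeff] dE -> vT ET]]]].
  by apply: TT_OpE oE oeff _ _ vT _ => //; apply: ET_AppR v1T ET le_eff.
- move=> o ss n v E o' As D _ eff /ttyped_Op[A' [B' [o'E o'eff -> +]]].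
  move=> /ttyped_OpE[A [B [Cs [[oE oeff] dE -> vT ET]]]].
  by apply: TT_OpE oE oeff _ _ vT _ => //; apply: ET_Op o'E o'eff _ ET.
- move=> o ss n v E h o_h D C eff.
  move=> /ttyped_Handle[A' [eff1 [eff2 [+ hT le_eff]]]].
  move=> /ttyped_OpE[A [B [Cs [[oE oeff] dE -> vT ET]]]].
  apply: TT_OpE oE _ _ _ vT _ => //; last exact: ET_Handle ET hT le_eff.
  exact/(fsubsetP le_eff)/(ops_unhandled hT oeff).
- move=> m o ss n v E e2 D C eff /ttyped_Let[A' + e2T].
  move=> /ttyped_OpE[A [B [Cs [[oE oeff] dE -> vT ET]]]].
  apply: (ttyped_OpE_intro _ oE oeff) => //=; last exact: ET_Let ET e2T.
  + by rewrite dE.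
  + by rewrite -map_comp; apply: eq_map.
  (* The merged binder puts the [n] inner variables first, so [v] and its type need no
     renumbering. *)
  + by rewrite addnC -shift_ctx_add.
- move=> o ss n v E h m e _ dE hE ssm As th e1 _ _ D C eff.
  move=> /ttyped_Handle[A' [eff1 [eff2 [+ hT le_eff]]]].
  move=> /ttyped_OpE[A [B [Cs [[oE oeff] _ ssE vT ET]]]].
  have AsE : As = Cs by rewrite /As ssE -map_comp map_id.
  have [_ _ eT] := clause_typed oE dE vT ET hT hE.
  apply: (ttyped_eff _ le_eff); rewrite /e1 /th AsE; apply: sub1_typed eT _.
  (* [D] does not mention bs, so sending bs to bot merely removes its shift. *)
  have := shift_ctx_inst (nseq n (TBase (bot L))) D; rewrite size_nseq => DE.
  by move: (vtyped_tsub vT (bots n)); rewrite DE shift_ctx0.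
Qed.

Lemma step_typed e e' A eff :
  step e e' -> ttyped nil None e A eff -> ttyped nil None e' A eff.
Proof.
case=> E {}e {}e' /red_typed r; elim: E A eff => /=.
- exact: r.
- move=> E IH e2 C eff /ttyped_App[A [eff' [/IH e1T e2T le_eff]]].
  exact: TT_App e1T e2T le_eff.
- move=> v E IH C eff /ttyped_App[A [eff' [vT /IH e2T le_eff]]].
  exact: TT_App vT e2T le_eff.
- move=> o Cs E IH C eff /ttyped_Op[A [B [oE oeff -> /IH eT]]].
  exact: TT_Op oE oeff _ eT.
- move=> E IH h C eff /ttyped_Handle[A [eff1 [eff2 [/IH eT hT le_eff]]]].
  exact: TT_Handle eT hT le_eff.
- move=> n E IH e2 C eff /ttyped_Let[A /IH e1T e2T].
  (* The empty context and [None] are unchanged below the type binders of the let, so the induction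
     can stay at [nil]. *)
  exact: (TT_Let (D := nil) (R := None) e1T e2T).
Qed.

Lemma steps_typed e e' A eff :
  steps e e' -> ttyped nil None e A eff -> ttyped nil None e' A eff.
Proof. by elim=> [? ? /step_typed|//|? ? ? _ IH1 _ IH2 /IH1]; auto. Qed.

(** * Progress and absence of stuck terms *)

Lemma red_step (e e' : tm L) : red e e' -> step e e'.
Proof. exact: (@Step _ EHole). Qed.

Variant progress (e : tm L) : Prop :=
  | ProgressVal v of e = Val v
  | ProgressOpE o ss n v E of e = OpE o ss n v E
  | ProgressStep e' of step e e'.

(** Evaluation positions lie below type binders only, which leave [nil] and [None] unchanged. A
    suspended operation must be allowed as an outcome because subterms of a closed program can have
    a nonempty effect. *)
Lemma ttyped_progress e A eff : ttyped nil None e A eff -> progress e.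
Proof.
elim: e A eff =>
  [x Cs|v|e1 IH1 e2 IH2|n e1 IH e2 _|o Cs e IH|o ss n v E|e IH h|m e _] C eff.
- by inversion 1 as [? ? ? ? ? ? ? xE| | | | | | |]; rewrite onth0n in xE.
- by move=> _; apply: ProgressVal.
- move=> /ttyped_App[A [eff' [e1T e2T _]]].
  case: (IH1 _ _ e1T) => [v1 e1E|o ss n v E ->|_ [E e e' r]]; last first.
  + exact: ProgressStep (Step (EAppL E e2) r).
  + exact/ProgressStep/red_step/R_OpAppL.
  rewrite {e1 IH1}e1E in e1T *.
  case: (IH2 _ _ e2T) => [v2 e2E|o ss n v E ->|_ [E e e' r]]; last first.
  + exact: ProgressStep (Step (EAppR v1 E) r).
  + exact/ProgressStep/red_step/R_OpAppR.
  rewrite {e2 IH2}e2E in e2T *; have v1T := ttyped_Val e1T.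
  case: (vtyped_TArr v1T) => [[e -> eT]|[i [c [-> cE AE _]]]].
    apply/ProgressStep/red_step/R_Beta.
    exact: ttyped_arity eT _ _ _ _.
  move: (ttyped_Val e2T); rewrite AE.
  (* A value of base type is a constant, as an abstraction has an arrow type. *)
  move TE: (TBase i) => T v2T; case: v2T TE => // _ _ c2 c2E.
  have [|c3 c3E] := proj2 (zeta_defined c c2); first by exists i, C.
  exact: ProgressStep (red_step (R_Const c3E)).
- move=> /ttyped_Let[A e1T e2T].
  case: (IH _ _ e1T) => [v ->|o ss k v E ->|_ [E e e' r]].
  + apply/ProgressStep/red_step/R_Let.
    exact: ttyped_arity e2T _ _ _ _.
  + exact/ProgressStep/red_step/R_OpLet.
  + exact: ProgressStep (Step (ELet n E e2) r).
- move=> /ttyped_Op[A [B [_ _ _ eT]]].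
  case: (IH _ _ eT) => [v ->|o' ss n v E ->|_ [E e1 e2 r]].
  + exact/ProgressStep/red_step/R_Op.
  + exact/ProgressStep/red_step/R_OpOp.
  + exact: ProgressStep (Step (EOp o Cs E) r).
- by move=> _; apply: ProgressOpE.
- move=> /ttyped_Handle[A [eff1 [eff2 [eT hT le_eff]]]].
  case: (IH _ _ eT) => [v ->|o ss n v E eE|_ [E e1 e2 r]]; last first.
  + exact: ProgressStep (Step (EHandle E h) r).
  + rewrite {e IH}eE in eT *.
    case: (boolP (o \in ops h)) => [/hop_ops[m [e hE]]|o_h]; last first.
      exact/ProgressStep/red_step/R_OpHandle.
    have [A0 [B0 [Cs [[oE oeff] dE ssE vT ET]]]] := ttyped_OpE eT.
    have [szC def e1T] := clause_typed oE dE vT ET hT hE.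
    have AsE : [seq s.2 | s <- ss] = Cs by rewrite ssE -map_comp map_id.
    apply/ProgressStep/red_step; apply: (R_Handle _ dE hE).
    * by rewrite ssE; elim: (Cs) => //= C0 Cs0 ->; rewrite eqxx.
    * by rewrite ssE size_map.
    * by rewrite AsE.
    * by rewrite AsE; apply: ttyped_arity e1T _ _ _ _.
  + apply/ProgressStep/red_step/R_Return.
    exact: ttyped_arity (hret_typed hT) _ _ _ _.
- by inversion 1.
Qed.

Lemma ttyped_not_stuck e A : ttyped nil None e A fset0 -> not_stuck e.
Proof.
move=> eT e' /steps_typed /(_ eT) e'T nostep.
case: (ttyped_progress e'T) => [v ->|o ss n v E e'E|e'' st].
- by exists v.
- by move: e'T; rewrite e'E => /ttyped_OpE[? [? [? [[]]]]]; rewrite in_fset0.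
- by case: nostep; exists e''.
Qed.

End Typing.

(** * Existence of elaborations and typing of their outputs *)

Section Elaboration.
Variable L : language.

Scheme typing_mut := Minimality for typing Sort Prop
  with htyping_mut := Minimality for htyping Sort Prop.
Combined Scheme typing_htyping_mut from typing_mut, htyping_mut.

Scheme elab_mut := Minimality for elab Sort Prop
  with helab_mut := Minimality for helab Sort Prop.
Combined Scheme elab_helab_mut from elab_mut, helab_mut.

(** The elaboration rules mirror the typing rules; [S] is generalized because binders and resumes
    modify it. *)
Lemma typing_elab :
  (forall G R (M : stm L) A eff, typing G R M A eff ->
     forall S, exists e, elab G R M A eff S e) /\
  (forall G R (H : shandler L) A eff B eff', htyping G R H A eff B eff' ->
     forall S, exists h, helab G R H A eff B eff' S h).
Proof.
apply: typing_htyping_mut; try by move=> *; eexists; econstructor; eauto.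
- move=> G R M A B eff eff' _ IH S; have [e eE] := IH (up_ren S).
  by eexists; apply: E_Abs eE.
- move=> G R M1 M2 A B eff eff' _ IH1 _ IH2 le_eff S.
  have [e1 e1E] := IH1 S; have [e2 e2E] := IH2 S.
  by eexists; apply: E_App e1E e2E le_eff.
- move=> G R M1 M2 n A B eff _ IH1 _ IH2 S.
  have [e1 e1E] := IH1 S; have [e2 e2E] := IH2 (up_ren S).
  by eexists; apply: E_Let e1E e2E.
- move=> G R M A eff eff' _ IH le_eff S; have [e eE] := IH S.
  by eexists; apply: E_Weak eE le_eff.
- move=> G R o M n A B Cs eff oE oeff _ IH szC inC S; have [e eE] := IH S.
  by eexists; apply: E_Op oE oeff eE szC inC.
- move=> G R M H A B eff eff' _ IHM _ IHH S.
  have [e eE] := IHM S; have [h hE] := IHH S.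
  by eexists; apply: E_Handle eE hE.
- move=> G1 G2 C als A B C' eff eff' M wfG dals le_eff _ IH S.
  have [e eE] := IH (resume_map (ntm G2) S).
  by eexists; apply: E_Resume wfG dals le_eff eE.
- move=> G R M A B eff eff' _ IH le_eff S; have [e eE] := IH (up_ren S).
  by eexists; apply: E_HRet eE le_eff.
- move=> G R H o M n A B C D eff eff' _ IHH oE wfR _ IHM o_eff S.
  have [h hE] := IHH S; have [e eE] := IHM (up_ren S).
  by eexists; apply: E_HOp hE oE wfR eE o_eff.
Qed.

(* The type variables of the clause are declared [k] binders ago, where its
   surface resumption type was written. *)
Inductive res_of : resty L -> res L -> Prop :=
  | ResNone : res_of RNone None
  | ResSome o m A B k x eff C :
      sig o = (m, A, B) ->
      res_of (RSome (map (addn k) (iota 0 m)) x (tysub (tshift k) A)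
                    (tysub (tshift k) B) eff C)
             (Some (o, eff, C)).

(** Inclusion is enough: below a resume the intermediate context still declares the clause variable,
    which the surface context has replaced. *)
Definition ctx_of (G : context L) (S : nat -> nat) (D : seq (lscheme L)) :=
  forall x sg, lookup G x = Some sg -> onth D (S x) = Some sg.

Lemma lookup_tyvars (G : context L) n x :
  lookup (tyvars n ++ G) x = omap (scsub (tshift n)) (lookup G x).
Proof.
elim: n => [|n IH] /=.
  by case: (lookup G x) => //= sg; rewrite -[in LHS](scsub_id sg).
rewrite IH; case: (lookup G x) => //= sg; congr Some.
by rewrite scsub_comp; apply: eq_scsub.
Qed.

Lemma res_of_ty k R R' : res_of R R' ->
  res_of (rshift_ty k R) (ressub (tshift k) R').
Proof.
case=> [|o m A B j x eff C oE] /=; first exact: ResNone.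
have comp A1 :
    tysub (tshift k) (tysub (tshift j) A1) = tysub (tshift (k + j)) A1.
  by rewrite tysub_comp; apply: eq_tysub => a; rewrite /= /tshift addnA.
have -> : [seq k + i | i <- [seq j + i | i <- iota 0 m]]
          = map (addn (k + j)) (iota 0 m).
  by rewrite -map_comp; apply: eq_map => i; rewrite /= addnA.
by rewrite !comp; apply: ResSome.
Qed.

Lemma res_of_tm R R' : res_of R R' -> res_of (rshift_tm R) R'.
Proof. by case=> *; constructor. Qed.

Lemma ctx_of_tm G S D sg :
  ctx_of G S D -> ctx_of (ETm sg :: G) (up_ren S) (sg :: D).
Proof. by move=> GD [|x] //= sg'; apply: GD. Qed.

Lemma ctx_of_ty G S D n :
  ctx_of G S D -> ctx_of (tyvars n ++ G) S (shift_ctx n D).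
Proof.
move=> GD x sg; rewrite lookup_tyvars; case Gx: (lookup G x) => [sg'|] //= <-.
by rewrite onth_map (GD _ _ Gx).
Qed.

(** The clause variables have indices [k] to [k + m - 1], and the copy sends the i-th of them to i,
    undoing the shift. The body of a resume is thus typed at the bare signature. *)
Lemma fresh_copy_shift m k (A : lty L) : all (fun a => a < m) (ftv A) ->
  fresh_copy (map (addn k) (iota 0 m)) (tysub (tshift k) A) = A.
Proof.
move=> cA; rewrite /fresh_copy tysub_comp; apply: tysub_closed cA _.
move=> a lt_am /=; congr TVar; rewrite index_map; last exact: addnI.
by rewrite -{1}[a](nth_iota 0 0 lt_am) ?index_uniq ?size_iota ?iota_uniq.
Qed.

(** Removing a term declaration renumbers term indices exactly as in [resume_map] and leaves type
    indices, hence schemes, alone. *)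
Lemma lookup_remove (G1 G2 : context L) sg z :
  lookup (G2 ++ G1) z
  = lookup (G2 ++ ETm sg :: G1) (if z < ntm G2 then z else z.+1).
Proof.
elim: G2 z => [|[sg'|] G2 IH] z //=; last by rewrite IH.
by case: z => [|z] //=; rewrite IH ltnS; case: ifP.
Qed.

Lemma elab_typed :
  (forall G R (M : stm L) A eff S e, elab G R M A eff S e ->
     forall R' D, res_of R R' -> ctx_of G S D -> ttyped D R' e A eff) /\
  (forall G R (H : shandler L) A eff B eff' S h,
     helab G R H A eff B eff' S h ->
     forall R' D, res_of R R' -> ctx_of G S D -> htyped D R' h A eff B eff').
Proof.
have hres := res_of_tm; have htm := ctx_of_tm.
apply: elab_helab_mut; try by move=> *; econstructor; eauto.
- by move=> *; do 2!constructor.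
- move=> G R M A B eff eff' S e _ IH R' D RR' GD.
  by do 2!constructor; apply: IH; auto.
- move=> G R M1 M2 n A B eff S e1 e2 _ IH1 _ IH2 R' D RR' GD.
  apply: TT_Let; last by apply: IH2; auto.
  by apply: IH1; [apply: res_of_ty | apply: ctx_of_ty].
- move=> G R M A eff eff' S e _ IH le_eff R' D RR' GD.
  by apply: (ttyped_eff _ le_eff); apply: IH.
- move=> G1 G2 D0 als A B C eff eff' M S e _ _ le_eff _ IH R' D RR' GD.
  (* Inverting [res_of] recovers the enclosing operation and the depth [k] of its clause. *)
  move RE: (RSome _ _ _ _ _ _) RR' => R RR'.
  case: RR' RE => // o m A1 B1 k x eff1 C1 oE [alsE _ AE BE effE CE].
  have [cA cB] : all (fun a => a < m) (ftv A1) /\ all (fun a => a < m) (ftv B1).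
    by move: (sig_closed oE); rewrite all_cat => /andP.
  have szals : size als = m by rewrite alsE size_map size_iota.
  rewrite szals -effE -CE; apply: (TT_Resume oE le_eff).
  rewrite -(fresh_copy_shift k cB) -alsE -BE; apply: IH.
    rewrite /resume_res szals alsE AE BE.
    exact: (res_of_ty _ (ResSome k _ _ _ oE)).
  rewrite /resume_ctx szals alsE AE fresh_copy_shift //; apply: ctx_of_tm.
  apply: ctx_of_ty => z sg; rewrite (lookup_remove _ _ (mono D0)); exact: GD.
- move=> G R H o M n A B C C' eff eff' S h e _ IHH oE _ _ IHM _ R' D RR' GD.
  apply: (HT_Op (IHH _ _ RR' GD) oE); apply: IHM;
    last exact/ctx_of_tm/ctx_of_ty.
  (* On entering a clause no further type binder has been crossed, so [k] is 0. *)
  have := ResSome 0 0 eff' (tysub (tshift n) B) oE.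
  by rewrite map_id_in // !tysub_id.
Qed.

End Elaboration.

Theorem corollary1 (L : language) (M : stm L) (A : lty L)
  (hM : typing nil RNone M A fset0) :
  exists e : tm L, elab nil RNone M A fset0 id e /\ not_stuck e.
Proof.
have [e eE] := proj1 (typing_elab L) _ _ _ _ _ hM id; exists e; split=> //.
apply: (@ttyped_not_stuck _ _ A).
by apply: (proj1 (elab_typed L)) eE _ _ _ _; first exact: ResNone.
Qed.
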